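(* Let $\mathbb K\in\{\mathbb R,\mathbb C\}$ and let $(E,[\cdot,\cdot])$ be a locally convex Poisson vector space over $\mathbb K$ with respect to $\mathcal S=c$. Let $U\subseteq E$ be open. Then the Poisson bracket $$\{\cdot,\cdot\}\colon C^\infty_{\mathbb K}(U,\mathbb K)\times C^\infty_{\mathbb K}(U,\mathbb K)\to C^\infty_{\mathbb K}(U,\mathbb K)$$ is $c$-hypocontinuous in its second variable. If $[\cdot,\cdot]\colon E'_c\times E'_c\to E'_c$ is continuous, then also the Poisson bracket is continuous.
   Context: All locally convex spaces are Hausdorff. For a locally convex $\mathbb K$-vector space $E$, $E'_c$ is the space of continuous linear functionals with the topology of uniform convergence on compact subsets of $E$; $\eta_{E,c}\colon E\to(E'_c)'_c$, $\eta_{E,c}(x)(\lambda)=\lambda(x)$. A topological space is a $k_{\mathbb R}$-space if it is Hausdorff and each real-valued function on it which is continuous on every compact subset is continuous. A bilinear map $\beta\colon E_1\times E_2\to F$ between locally convex spaces is $c$-hypocontinuous in its second argument if it is separately continuous and for each compact $M\subseteq E_2$ and each $0$-neighbourhood $W\subseteq F$ there is a $0$-neighbourhood $V\subseteq E_1$ with $\beta(V\times M)\subseteq W$. A locally convex Poisson vector space with respect to $\mathcal S=c$ is a locally convex $\mathbb K$-vector space $E$ such that $E\times E$ is a $k_{\mathbb R}$-space and $\eta_{E,c}$ is a topological embedding, together with a bilinear map $[\cdot,\cdot]\colon E'_c\times E'_c\to E'_c$ which makes $E'_c$ a Lie algebra, is $c$-hypocontinuous in its second argument, and satisfies $\eta_{E,c}(x)\circ\mathrm{ad}_\lambda\in\eta_{E,c}(E)$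 for all $x\in E$ and $\lambda\in E'$, where $\mathrm{ad}_\lambda:=[\lambda,\cdot]\colon E'\to E'$. A map $f\colon U\to F$ from an open subset $U\subseteq E$ to a locally convex $\mathbb K$-space is $C^\infty_{\mathbb K}$ if it is continuous and all iterated directional derivatives $d^jf(x,y_1,\ldots,y_j)=(D_{y_j}\cdots D_{y_1}f)(x)$ over $\mathbb K$, $j\in\mathbb N$, exist and define continuous maps $d^jf\colon U\times E^j\to F$. $C^\infty_{\mathbb K}(U,F)$ is the space of such maps, endowed with the compact-open $C^\infty$-topology: the initial topology with respect to the maps $C^\infty_{\mathbb K}(U,F)\to C(U\times E^j,F)_{c.o.}$, $f\mapsto d^jf$, $j\in\mathbb N_0$ ($d^0f=f$), where the right-hand sides carry the compact-open topology. The Poisson bracket of $f,g\in C^\infty_{\mathbb K}(U,\mathbb K)$ is the function $\{f,g\}\colon U\to\mathbb K$, $\{f,g\}(x):=[f'(x),g'(x)](x)$, where $f'(x)=df(x,\cdot)\in E'$; it is known to be $C^\infty_{\mathbb K}$. *)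

(* Defs.v *)
From HB Require Import structures.
From mathcomp Require Import all_boot all_order all_algebra sesquilinear.
From mathcomp Require Import all_classical all_reals all_analysis.
From mathcomp Require Import complex.
Set Implicit Arguments.
Unset Strict Implicit.
Unset Printing Implicit Defensive.
Import Order.TTheory GRing.Theory Num.Theory.
Import numFieldNormedType.Exports.
Local Open Scope classical_set_scope.
Local Open Scope ring_scope.

Definition real_or_complex (R : realType) (K : numFieldType) : Prop :=
  K = R :> numFieldType \/ K = R[i] :> numFieldType.

(* [tvsType] is the library's structure of locally convex spaces; it does not
   include separation. *)
HB.mixin Record isHausdorff T & Topological T := {
  is_hausdorff : hausdorff_space T }.

#[short(type="lcsType")]
HB.structure Definition LCS (K : numDomainType) :=
  {E of Tvs K E & isHausdorff E}.

HB.instance Definition _ (K : numFieldType) :=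
  isHausdorff.Build K^o (@norm_hausdorff K K^o).

Definition kR_space (R : realType) (T : topologicalType) : Prop :=
  hausdorff_space T /\
  forall f : T -> R^o,
    (forall C : set T, compact C -> {within C, continuous f}) -> continuous f.

Definition topological_embedding (S T : topologicalType) (f : S -> T) : Prop :=
  injective f /\ @open S = [set f @^-1` B | B in @open T].

Section Hypocontinuity.
Context {K : numFieldType} {E1 E2 F : preTopologicalLmodType K}.
Implicit Type b : E1 -> E2 -> F.

Definition bilinear_map b : Prop := bilinear_for *:%R *:%R b.

Definition separately_continuous b : Prop :=
  (forall x, continuous (b x)) /\ (forall y, continuous (b ^~ y)).

Definition c_hypocontinuous_snd b : Prop :=
  [/\ bilinear_map b, separately_continuous b &
      forall (M : set E2) (W : set F), compact M -> nbhs 0 W ->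
        exists2 V : set E1, nbhs 0 V &
          forall x y, V x -> M y -> W (b x y)].

End Hypocontinuity.

Lemma cvg_lincomb (K : numFieldType) (F : tvsType K) (T : Type)
    (G : set_system T) (k : K) (f g : T -> F) (a b : F) : Filter G ->
  f @ G --> a -> g @ G --> b -> (fun t => k *: f t + g t) @ G --> k *: a + b.
Proof.
move=> FG fa gb.
have kfa : (fun t => k *: f t) @ G --> k *: a.
  have kf : (fun t => ((k : K^o), f t)) @ G --> ((k : K^o), a).
    apply: (@cvg_pair _ _ _ G (nbhs (k : K^o)) (nbhs a)) => //.
    exact: (@cvg_cst K^o).
  exact: cvg_comp kf (@scale_continuous K F ((k : K^o), a)).
have kfg : (fun t => (k *: f t, g t)) @ G --> (k *: a, b).
  exact: (@cvg_pair _ _ _ G (nbhs (k *: a)) (nbhs b)).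
exact: cvg_comp kfg (@add_continuous F (k *: a, b)).
Qed.

Section Dual.
Context {K : numFieldType} (E : preTopologicalLmodType K).

Definition cdual_pred : {pred E -> K^o} :=
  fun f => `[< linear f /\ continuous f >].

Lemma cdual_pred_submod_closed : submod_closed cdual_pred.
Proof.
split.
  apply/asboolP; split; last exact: cst_continuous.
  by move=> a x y /=; rewrite -[LHS]/(0 : K^o) -[X in _ + X]/(0 : K^o)
    -[X in _ *: X]/(0 : K^o) scaler0 addr0.
move=> a f g /asboolP[lf cf] /asboolP[lg cg]; apply/asboolP; split.
  move=> b x y; rewrite -[LHS]/(a *: f (b *: x + y) + g (b *: x + y)).
  rewrite -[RHS]/(b *: (a *: f x + g x) + (a *: f y + g y)).
  by rewrite lf lg !scalerDr !scalerA [a * b]mulrC addrACA.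
by move=> x; apply: (@cvg_lincomb K K^o); [exact: cf|exact: cg].
Qed.

Record cdual := CDual { cdual_fun :> E -> K^o ; _ : cdual_fun \in cdual_pred }.

HB.instance Definition _ := GRing.isSubmodClosed.Build K (E -> K^o) cdual_pred
  cdual_pred_submod_closed.
HB.instance Definition _ := [isSub for cdual_fun].
HB.instance Definition _ := [Choice of cdual by <:].
HB.instance Definition _ := [SubChoice_isSubLmodule of cdual by <:].

(* The topology of uniform convergence on compact sets. *)
HB.instance Definition _ := Topological.copy cdual
  (initial_topology (cdual_fun : cdual -> {family compact, E -> K^o})).

Lemma cdual_linear (l : cdual) : linear l.
Proof. by case: l => f /= /asboolP[]. Qed.

Lemma cdual_continuous (l : cdual) : continuous l.
Proof. by case: l => f /= /asboolP[]. Qed.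

End Dual.
Arguments cdual_fun {K E} _ _.

Section Evaluation.
Context {K : numFieldType} (E : preTopologicalLmodType K).

Lemma eval_in_cdual (x : E) : (fun l : cdual E => l x) \in @cdual_pred K (cdual E).
Proof.
apply/asboolP; split; first by [].
move=> l.
have cvl : {family compact, cdual_fun @ l --> cdual_fun l}.
  exact: (@initial_continuous (cdual E) {family compact, E -> K^o}).
have FF := fmap_filter cdual_fun (nbhs_filter l).
have ptw := @pointwise_cvg_compact_family _ _ _ _ FF cvl.
exact: (iffLR (@pointwise_cvgP _ _ _ _ FF) ptw x).
Qed.

Definition eta (x : E) : cdual (cdual E) := CDual (eval_in_cdual x).

End Evaluation.

Section Poisson.
Context {K : numFieldType}.

Definition lie_bracket (L : lmodType K) (b : L -> L -> L) : Prop :=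
  [/\ bilinear_for *:%R *:%R b, forall x, b x x = 0 &
      forall x y z, b x (b y z) + b y (b z x) + b z (b x y) = 0].

Definition lc_poisson (R : realType) (E : lcsType K)
    (b : cdual E -> cdual E -> cdual E) : Prop :=
  [/\ kR_space R (E * E)%type, topological_embedding (@eta K E),
      lie_bracket b, c_hypocontinuous_snd b &
      forall (x : E) (l : cdual E),
        exists y : E, eta x \o b l = eta y :> (cdual E -> K)].

End Poisson.

Section Smooth.
Context {K : numFieldType} {E : preTopologicalLmodType K} {F : lcsType K}
  {U : set E}.
Implicit Type f : U -> F.

(* [valL_ 0 f] extends [f] by 0 outside [U]; when [U] is open this does not
   affect the limit below. *)
Definition diff_quot f (y : E) (x : U) : K^o -> F :=
  fun t => t^-1 *: ('valL_ 0 f (set_val x + t *: y) - f x).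

Definition dir_derivable f (y : E) (x : U) : Prop :=
  exists z : F, diff_quot f y x t @[t --> (0 : K^o)^'] --> z.

Definition dir_deriv f (y : E) (x : U) : F :=
  xget 0 [set z : F | diff_quot f y x t @[t --> (0 : K^o)^'] --> z].

(* For [ys = [:: y_1; ...; y_j]] this is D_{y_j} ( ... (D_{y_1} f)). *)
Fixpoint iter_deriv f (ys : seq E) : U -> F :=
  if ys is y :: ys' then iter_deriv (dir_deriv f y) ys' else f.

Fixpoint iter_derivable f (ys : seq E) : Prop :=
  if ys is y :: ys' then
    (forall x, dir_derivable f y x) /\ iter_derivable (dir_deriv f y) ys'
  else True.

(* d^j f (x, y_1, ..., y_j), where y_i is [p.2 (i - 1)]. *)
Definition dn (j : nat) f (p : U * {ptws 'I_j -> E}) : F :=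
  iter_deriv f [seq p.2 i | i : 'I_j] p.1.

Definition smooth f : Prop :=
  (forall ys, iter_derivable f ys) /\
  (forall j, continuous (@dn j f : (U * {ptws 'I_j -> E})%type -> F)).

Lemma dir_derivP f y x z :
  diff_quot f y x t @[t --> (0 : K^o)^'] --> z -> dir_deriv f y x = z.
Proof.
move=> fz; apply: xget_unique => // w fw.
exact: (@cvg_unique _ is_hausdorff _ _ _ _ fw fz).
Qed.

Lemma dir_derivableP f y x : dir_derivable f y x ->
  diff_quot f y x t @[t --> (0 : K^o)^'] --> dir_deriv f y x.
Proof. by move=> [z /[dup] /dir_derivP ->]. Qed.

Lemma valL_lincomb (a : K) f g x :
  'valL_ 0 (a *: f + g) x = a *: 'valL_ 0 f x + 'valL_ 0 g x :> F.
Proof.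
by rewrite /valL_ /=; case: ('oinv_set_val x) => //=; rewrite scaler0 addr0.
Qed.

Lemma diff_quot_lincomb (a : K) f g y x t :
  diff_quot (a *: f + g) y x t = a *: diff_quot f y x t + diff_quot g y x t.
Proof.
rewrite /diff_quot valL_lincomb scalerA mulrC -scalerA -scalerDr; congr (_ *: _).
by rewrite scalerBr opprD addrACA.
Qed.

Lemma dir_deriv_lincomb_cvg (a : K) f g y x :
  dir_derivable f y x -> dir_derivable g y x ->
  diff_quot (a *: f + g) y x t @[t --> (0 : K^o)^'] -->
    a *: dir_deriv f y x + dir_deriv g y x.
Proof.
move=> /dir_derivableP df /dir_derivableP dg.
under eq_fun do rewrite diff_quot_lincomb.
exact: cvg_lincomb.
Qed.

Lemma iter_deriv_lincomb (a : K) ys f g :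
  iter_derivable f ys -> iter_derivable g ys ->
  iter_derivable (a *: f + g) ys /\
  iter_deriv (a *: f + g) ys = a *: iter_deriv f ys + iter_deriv g ys.
Proof.
elim: ys f g => [//|y ys IH] f g /= [df dfs] [dg dgs].
have -> : dir_deriv (a *: f + g) y = a *: dir_deriv f y + dir_deriv g y.
  by apply/funext => x; apply/dir_derivP/dir_deriv_lincomb_cvg.
have [IH1 IH2] := IH _ _ dfs dgs.
do 2!split=> //; move=> x; exists (a *: dir_deriv f y x + dir_deriv g y x).
exact: dir_deriv_lincomb_cvg.
Qed.

Lemma iter_deriv0 ys : iter_derivable 0 ys /\ iter_deriv 0 ys = 0.
Proof.
have d0 y x : diff_quot 0 y x t @[t --> (0 : K^o)^'] --> (0 : F).
  rewrite (_ : diff_quot 0 y x = fun=> 0); first exact: cvg_cst.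
  apply/funext => t; rewrite /diff_quot /valL_ /=.
  by case: ('oinv_set_val _) => /= *; rewrite subr0 scaler0.
elim: ys => [//|y ys [IH1 IH2]] /=.
have -> : dir_deriv 0 y = 0 by apply/funext => x; exact/dir_derivP/d0.
by do 2!split=> //; move=> x; exists 0; exact: d0.
Qed.

Definition smooth_pred : {pred U -> F} := fun f => `[< smooth f >].

Lemma smooth_pred_submod_closed : submod_closed smooth_pred.
Proof.
split.
  apply/asboolP; split=> [ys|j]; first by have [] := iter_deriv0 ys.
  rewrite (_ : @dn j 0 = fun=> 0); first exact: cst_continuous.
  by apply/funext => p; rewrite /dn (iter_deriv0 _).2.
move=> a f g /asboolP[df cf] /asboolP[dg cg]; apply/asboolP; split=> [ys|j].
  by have [] := iter_deriv_lincomb a (df ys) (dg ys).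
rewrite (_ : @dn j (a *: f + g) = fun p => a *: dn f p + dn g p).
  by move=> p; apply: cvg_lincomb; [exact: cf|exact: cg].
by apply/funext => p; rewrite /dn (iter_deriv_lincomb a (df _) (dg _)).2.
Qed.

End Smooth.

Section SmoothSpace.
Context {K : numFieldType} {E : preTopologicalLmodType K} (F : lcsType K)
  (U : set E).

Record Cinfty := Smooth {
  Cinfty_fun :> U -> F ; _ : Cinfty_fun \in @smooth_pred K E F U }.

HB.instance Definition _ := GRing.isSubmodClosed.Build K (U -> F)
  (@smooth_pred K E F U) smooth_pred_submod_closed.
HB.instance Definition _ := [isSub for Cinfty_fun].
HB.instance Definition _ := [Choice of Cinfty by <:].
HB.instance Definition _ := [SubChoice_isSubLmodule of Cinfty by <:].

(* The compact-open C^oo topology. *)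
HB.instance Definition _ := Topological.copy Cinfty
  (sup_topology (fun j : nat => Topological.class
    (initial_topology (fun f : Cinfty =>
      dn f : {compact-open, (U * {ptws 'I_j -> E})%type -> F})))).

End SmoothSpace.
Arguments Cinfty_fun {K E F U} _ _.

(* h(x) = [f'(x), g'(x)](x) on U. That f'(x) = df(x, .) is linear and continuous
   is part of the assertion, hence the witnesses l and m. *)
Definition is_poisson_bracket (K : numFieldType) (E : lcsType K) (U : set E)
    (b : cdual E -> cdual E -> cdual E) (f g h : U -> K^o) : Prop :=
  forall x : U, exists l m : cdual E,
    [/\ cdual_fun l = (fun y => dir_deriv f y x),
        cdual_fun m = (fun y => dir_deriv g y x) &
        h x = b l m (set_val x)].

(* Main.v *)
(* The iterated derivatives of {f, g} are sums of terms
   [f'_A(x), g'_B(x)](c x + z), where f'_A(x) is the continuous functional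
   d^{|A|+1} f(x, y_A, .).  A c-hypocontinuous bilinear map is continuous on E'_c x N
   for N compact, so these terms converge along every net whose base point and
   directions stay in compact sets, also when f and g vary, provided one of the two
   functions stays in a compact set or the bracket is continuous.  As uniform
   convergence on compact sets is tested on such nets, this gives the convergence of
   {f, g} in C^oo, hence both assertions.  By antisymmetry of the bracket the roles of
   f and g can be exchanged, whence separate continuity.

   It remains to see that {f, g} is smooth, i.e. that d^j {f, g} is continuous on all of
   U x E^j and not only on its compact subsets.  Only U x E is known to be a k_R-space
   (not U x E^j), so one shows that (x, y) |-> d^j {f, g}(x, y, ..., y) is continuous and
   polarizes; this needs the symmetry of higher derivatives. *)

Require Import Defs.
From HB Require Import structures.
From mathcomp Require Import all_boot all_order all_algebra.
From mathcomp Require Import all_classical all_reals all_analysis.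
From mathcomp Require Import complex.
From mathcomp Require Import ring lra zify.
Set Implicit Arguments.
Unset Strict Implicit.
Unset Printing Implicit Defensive.
Import Order.TTheory GRing.Theory Num.Theory.
Import numFieldNormedType.Exports.
Local Open Scope classical_set_scope.
Local Open Scope ring_scope.

(** * Limits along filters *)

Lemma cvg_near_eq (T : Type) (U : topologicalType) (F : set_system T) (f g : T -> U)
    (l : U) : Filter F ->
  (\forall x \near F, f x = g x) -> f @ F --> l -> g @ F --> l.
Proof. by move=> FF fg fl P /fl; apply: filterS2 fg => x /= <-. Qed.

Lemma cvg_ext (T : Type) (U : topologicalType) (F : set_system T) (f g : T -> U)
    (l m : U) : f =1 g -> l = m -> f @ F --> l -> g @ F --> m.
Proof. by move=> /funext -> ->. Qed.

Lemma cvg_pair_topology (I : Type) (F : set_system I) {FF : Filter F}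
    (T S : topologicalType) (u : I -> T) (v : I -> S) (t : T) (s : S) :
  u @ F --> t -> v @ F --> s -> (fun i => (u i, v i)) @ F --> (t, s).
Proof. by move=> ut vs; exact: (@cvg_pair _ _ _ F (nbhs t) (nbhs s)). Qed.

Lemma continuous_fst (T S : topologicalType) : continuous (fst : T * S -> T).
Proof. by move=> p; exact: cvg_fst. Qed.

Lemma continuous_snd (T S : topologicalType) : continuous (snd : T * S -> S).
Proof. by move=> p; exact: cvg_snd. Qed.

(** * The two scalar fields *)

(* What is needed of K = R (with [im = 0]) and of K = R[i] (with [imag_unit] = i). *)
Record real_coordinates (R : realType) (K : numFieldType) := RealCoordinates {
  of_real : {rmorphism R -> K};
  re : {additive K -> R};
  im : {additive K -> R};
  imag_unit : K;
  of_real_le : {mono of_real : x y / x <= y};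
  of_real_norm : forall r, `|of_real r| = of_real `|r|;
  of_real_re : forall e, 0 <= e -> of_real (re e) = e;
  re_scale : forall r z, re (of_real r * z) = r * re z;
  im_scale : forall r z, im (of_real r * z) = r * im z;
  re_norm : forall z, of_real `|re z| <= `|z|;
  im_norm : forall z, of_real `|im z| <= `|z|;
  imag_unit_norm : `|imag_unit| <= 1;
  re_im : forall z, z = of_real (re z) + imag_unit * of_real (im z) }.

Lemma real_or_complex_coordinates (R : realType) (K : numFieldType) :
  real_or_complex R K -> inhabited (real_coordinates R K).
Proof.
case=> ->.
  constructor; apply: (@RealCoordinates R R idfun idfun (\0 : {additive R -> R}) 0) => //=.
  - by move=> e z; rewrite mulr0.
  - by move=> z; rewrite normr0.
  - by rewrite normr0.
  - by move=> z; rewrite mul0r addr0.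
have reD : additive (@complex.Re R) by move=> [a b] [c d].
have imD : additive (@complex.Im R) by move=> [a b] [c d].
pose reM := GRing.isAdditive.Build _ _ (@complex.Re R) reD.
pose imM := GRing.isAdditive.Build _ _ (@complex.Im R) imD.
pose reA : {additive R[i] -> R} := HB.pack (@complex.Re R) reM.
pose imA : {additive R[i] -> R} := HB.pack (@complex.Im R) imM.
constructor; apply: (@RealCoordinates R R[i] (real_complex R) reA imA 'i%C).
- by move=> x y /=; rewrite lecR.
- by move=> r; rewrite normc_def /= expr0n addr0 sqrtr_sqr.
- by move=> e e0; apply: RRe_real; exact: ger0_real.
- by move=> r [a b] /=; rewrite mul0r subr0.
- by move=> r [a b] /=; rewrite mul0r addr0.
- by move=> [a b]; rewrite normc_def /= lecR -sqrtr_sqr ler_wsqrtr// lerDl sqr_ge0.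
- by move=> [a b]; rewrite normc_def /= lecR -sqrtr_sqr ler_wsqrtr// lerDr sqr_ge0.
- by rewrite normc_def /= expr0n expr1n add0r sqrtr1.
- exact: complexE.
Qed.

Section RealCoordinates.
Context (R : realType) (K : numFieldType) (rc : real_coordinates R K).

Lemma of_real_lt : {mono of_real rc : x y / x < y}.
Proof. exact: leW_mono (of_real_le rc). Qed.

Lemma of_real_re_gt0 (e : K) : 0 < e -> 0 < re rc e.
Proof. by move=> e0; rewrite -of_real_lt rmorph0 of_real_re// ltW. Qed.

Lemma of_real_continuous : continuous (of_real rc : R^o -> K^o).
Proof.
move=> x; apply/(@cvgrPdist_lt _ K^o _ (nbhs (x : R^o))) => e e0; near=> y.
rewrite -rmorphB of_real_norm -(of_real_re rc (ltW e0)) of_real_lt; near: y.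
exact: (@nbhsx_ballx R R^o _ _ (of_real_re_gt0 e0)).
Unshelve. all: by end_near. Qed.

Lemma re_continuous : continuous (re rc : K^o -> R^o).
Proof.
move=> x; apply/(@cvgrPdist_lt _ R^o _ (nbhs (x : K^o))) => e e0; near=> y.
rewrite -raddfB -of_real_lt (le_lt_trans (re_norm _ _))//; near: y.
by apply: (@nbhsx_ballx K K^o); rewrite -(rmorph0 (of_real rc)) of_real_lt.
Unshelve. all: by end_near. Qed.

Lemma im_continuous : continuous (im rc : K^o -> R^o).
Proof.
move=> x; apply/(@cvgrPdist_lt _ R^o _ (nbhs (x : K^o))) => e e0; near=> y.
rewrite -raddfB -of_real_lt (le_lt_trans (im_norm _ _))//; near: y.
by apply: (@nbhsx_ballx K K^o); rewrite -(rmorph0 (of_real rc)) of_real_lt.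
Unshelve. all: by end_near. Qed.

Lemma of_re_im_cvg T (F : set_system T) (f g : T -> R^o) a b : Filter F ->
  f @ F --> a -> g @ F --> b ->
  (fun t => of_real rc (f t) + imag_unit rc * of_real rc (g t) : K^o) @ F -->
    (of_real rc a + imag_unit rc * of_real rc b : K^o).
Proof.
move=> FF fa gb; apply: (@cvgD K K^o).
  exact: cvg_comp fa (@of_real_continuous a).
apply: (@cvgM K); first exact: cvg_cst.
exact: cvg_comp gb (@of_real_continuous b).
Qed.

(** The square $[-1,1]^2$ is mapped onto such a set by $(a,b)\mapsto a+ib$. Local compactness of the
    scalars is what lets difference quotients be studied along nets staying in compact sets. *)
Lemma compact_nbhs0 : exists2 C : set K^o, nbhs 0 C & compact C.
Proof.
pose B : set (R^o * R^o) := `[-1, 1] `*` `[-1, 1].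
pose g (p : R^o * R^o) : K^o := of_real rc p.1 + imag_unit rc * of_real rc p.2.
exists (g @` B).
  near=> z; exists (re rc z, im rc z); last by rewrite /g /= -re_im.
  have z1 : `|z| <= 1.
    by near: z; exact: (@nbhs0_le K K^o).
  split=> /=; rewrite in_itv /= -ler_norml -(of_real_le rc) rmorph1.
    by apply: le_trans z1; exact: re_norm.
  by apply: le_trans z1; exact: im_norm.
apply: continuous_compact; last by apply: compact_setX; exact: segment_compact.
by apply: continuous_subspaceT => p; apply: of_re_im_cvg; [exact: cvg_fst|exact: cvg_snd].
Unshelve. all: by end_near. Qed.

(** The defining property concerns real-valued functions only; it is applied to the real and
    imaginary parts of [f], which are then recombined. *)
Lemma kR_spaceP (T : topologicalType) : kR_space R T -> forall f : T -> K^o,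
  (forall C : set T, compact C -> {within C, continuous f}) -> continuous f.
Proof.
move=> [_ kT] f cf.
have cre : continuous (re rc \o f : T -> R^o).
  apply: kT => C /cf cC x; apply: (@continuous_comp _ _ _ (f : subspace C -> K^o)).
    exact: cC.
  exact: re_continuous.
have cim : continuous (im rc \o f : T -> R^o).
  apply: kT => C /cf cC x; apply: (@continuous_comp _ _ _ (f : subspace C -> K^o)).
    exact: cC.
  exact: im_continuous.
move=> x; rewrite /continuous_at.
have -> : f = (fun t => of_real rc (re rc (f t)) + imag_unit rc * of_real rc (im rc (f t))).
  by apply/funext => t; exact: re_im.
by apply: of_re_im_cvg; [exact: cre|exact: cim].
Qed.

Lemma real_mean_value (u u' : R -> R) (c e : R) :
  (forall s : R, 0 <= s <= 1 -> is_derive (s : R^o) 1 (u : R^o -> R^o) (u' s)) ->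
  (forall s, 0 <= s <= 1 -> `|u' s - c| <= e) ->
  `|u 1 - u 0 - c| <= e.
Proof.
move=> du ue.
have [| |s s01 us] := @MVT_segment R u u' 0 1 ler01.
- by move=> s; rewrite in_itv /= => /andP[s0 s1]; apply: du; rewrite !ltW.
- by apply: derivable_within_continuous => s; rewrite in_itv /= => /du [].
by rewrite us subr0 mulr1; apply: ue; move: s01; rewrite in_itv.
Qed.

(* The constant 2 comes from bounding the real and imaginary parts separately. *)
Lemma mean_value (phi dphi : K -> K) (c e : K) :
  (forall s, 0 <= s <= 1 ->
    (fun h : K^o => h^-1 * (phi (s + h) - phi s) : K^o) @ 0^' --> (dphi s : K^o)) ->
  (forall s, 0 <= s <= 1 -> `|dphi s - c| <= e) ->
  `|phi 1 - phi 0 - c| <= e + e.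
Proof.
move=> dphiP dphie.
have e0 : 0 <= e by rewrite (le_trans _ (dphie 0 _))// ler01 lexx.
have i01 s : 0 <= s <= 1 -> 0 <= of_real rc s <= 1.
  by rewrite -(rmorph0 (of_real rc)) -(rmorph1 (of_real rc)) !of_real_le.
(* [p] stands for [re rc] or [im rc]. Along the real segment, [p \o phi \o of_real rc] is a real
   function with derivative [p (dphi s)], and [e], being nonnegative, is itself real. *)
have main (p : {additive K -> R}) : (forall r z, p (of_real rc r * z) = r * p z) ->
    (forall z, of_real rc `|p z| <= `|z|) -> continuous (p : K^o -> R^o) ->
    of_real rc `|p (phi 1 - phi 0 - c)| <= e.
  move=> pZ pn pc; rewrite -(of_real_re rc e0) of_real_le !raddfB.
  have := @real_mean_value (p \o phi \o of_real rc) (p \o dphi \o of_real rc) (p c) (re rc e).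
  rewrite /= rmorph0 rmorph1; apply.
    move=> s /i01 /dphiP sphi.
    have cv : (fun h : R^o => h^-1 *: ((p \o phi \o of_real rc) (h *: 1 + s)
        - (p \o phi \o of_real rc) s) : R^o) @ 0^' --> (p (dphi (of_real rc s)) : R^o).
      have i0 : (of_real rc : R^o -> K^o) @ 0^' --> 0^'.
        move=> A A0; have := @of_real_continuous 0 (fun y => y != 0 -> A y).
        rewrite rmorph0 => /(_ A0) {}A0.
        apply: (@filterS _ (nbhs (0 : R^o)) _ _ _ _ A0) => r /= Ar r0.
        by apply: Ar; rewrite fmorph_eq0.
      have pcv := cvg_comp _ _ (cvg_comp _ _ i0 sphi) (pc (dphi (of_real rc s))).
      apply: cvg_near_eq pcv; near=> h; rewrite /=.
      by rewrite -fmorphV pZ raddfB -rmorphD [h *: 1]mulr1 [h + s]addrC.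
    split; last exact: cvg_lim cv.
    by apply/cvg_ex; exists (p (dphi (of_real rc s))).
  move=> s /i01 /dphie; rewrite -raddfB -(of_real_le rc) of_real_re//.
  by apply: le_trans; exact: pn.
rewrite [X in `|X|](re_im rc) (le_trans (ler_normD _ _))// lerD//.
  by rewrite of_real_norm; apply: main; [exact: re_scale|exact: re_norm|exact: re_continuous].
rewrite normrM -[leRHS]mul1r ler_pM//; first exact: imag_unit_norm.
by rewrite of_real_norm; apply: main; [exact: im_scale|exact: im_norm|exact: im_continuous].
Unshelve. all: by end_near. Qed.

End RealCoordinates.

(** * Convergence within compact sets *)

(* Hypocontinuity and the topologies of compact convergence only control nets [u] that
   eventually stay in a compact set. *)
Definition compact_cvg (I : Type) (T : topologicalType) (F : set_system I)
    (u : I -> T) (t : T) :=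
  u @ F --> t /\ exists C : set T, [/\ compact C, C t & \forall i \near F, C (u i)].

Section CompactCvg.
Context (I : Type) (F : set_system I) {FF : Filter F}.
Implicit Types T S : topologicalType.

Lemma compact_cvg_cst T (t : T) : compact_cvg F (fun=> t) t.
Proof.
split; first exact: cvg_cst.
by exists [set t]; split=> //; [exact: compact_set1|exact: nearW].
Qed.

Lemma compact_cvg_pair T S (u : I -> T) (v : I -> S) t s :
  compact_cvg F u t -> compact_cvg F v s ->
  compact_cvg F (fun i => (u i, v i)) (t, s).
Proof.
move=> [ut [C [cC Ct uC]]] [vs [D [cD Ds vD]]]; split.
  exact: cvg_pair.
exists (C `*` D); split=> //; first exact: compact_setX.
by apply: filterS2 uC vD.
Qed.

(** Since [u] eventually stays in a compact set [C], only the restriction of [f] to [C] matters, and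
    [f \o u] eventually stays in the compact image of [C]. *)
Lemma compact_cvg_comp_within T S (f : T -> S) (u : I -> T) t :
  (forall (C : set T) t, compact C -> C t -> f @ within C (nbhs t) --> f t) ->
  compact_cvg F u t -> compact_cvg F (f \o u) (f t).
Proof.
move=> cf [ut [C [cC Ct uC]]]; split.
  move=> A /(cf C t cC Ct) nA; have := ut _ nA.
  by apply: filterS2 uC => i Ci; exact.
exists (f @` C); split; [|by exists t|].
  apply: continuous_compact => //; apply/subspace_continuousP => s Cs.
  exact: cf.
by apply: (filterS _ uC) => i Ci; exists (u i).
Qed.

Lemma compact_cvg_comp T S (f : T -> S) (u : I -> T) t :
  continuous f -> compact_cvg F u t -> compact_cvg F (f \o u) (f t).
Proof.
move=> cf; apply: compact_cvg_comp_within => C s _ _.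
by apply: cvg_within_filter; exact: cf.
Qed.

Lemma ptws_cvg J T (u : I -> {ptws 'I_J -> T}) (t : {ptws 'I_J -> T}) :
  (forall k, (u ^~ k) @ F --> t k) -> u @ F --> t.
Proof.
move=> ut; apply/cvg_sup => k; apply/cvg_image.
  by rewrite eqEsubset; split=> // y _; exists (fun=> y).
move=> A Ak; exists [set f | A (f k)]; first exact: (ut k _ Ak).
rewrite eqEsubset; split=> [_ [f ? <-]//|y Ay].
by exists (fun=> y).
Qed.

(** The product of compact sets chosen for the coordinates is compact by Tychonoff's theorem; as
    there are finitely many coordinates, the net is eventually in all of them at once. *)
Lemma compact_cvg_ptws J T (u : I -> {ptws 'I_J -> T}) (t : {ptws 'I_J -> T}) :
  (forall k, compact_cvg F (u ^~ k) (t k)) -> compact_cvg F u t.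
Proof.
move=> ut; split.
  by apply: ptws_cvg => k; have [] := ut k.
have /choice[C CP] : forall k, exists C : set T,
    [/\ compact C, C (t k) & \forall i \near F, C (u i k)].
  by move=> k; have [_] := ut k.
exists [set f : {ptws 'I_J -> T} | forall k, C k (f k)]; split.
- by apply: tychonoff => k; have [] := CP k.
- by move=> k; have [] := CP k.
- by apply: filter_forall => k; have [] := CP k.
Qed.

Lemma compact_cvg_reindex (J : Type) (G : set_system J) (p : J -> I)
    T (u : I -> T) t :
  Filter G -> p @ G --> F -> compact_cvg F u t -> compact_cvg G (u \o p) t.
Proof.
move=> FG pF [ut [C [cC Ct uC]]]; split; first exact: cvg_comp pF ut.
by exists C; split=> //; exact: (pF _ uC).
Qed.

(** The net on which continuity on a compact set is tested. *)
Lemma compact_cvg_within T (C : set T) t : compact C -> C t ->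
  compact_cvg (within C (nbhs t)) id t.
Proof.
move=> cC Ct; split; first by apply: cvg_within_filter; exact: cvg_id.
by exists C; split=> //; exact: withinT.
Qed.

End CompactCvg.

Lemma compact_cvg_continuous_within (T S : topologicalType) (f : T -> S) :
  (forall (C : set T) t, compact C -> C t -> f @ within C (nbhs t) --> f t) ->
  forall C : set T, compact C -> {within C, continuous f}.
Proof.
move=> fC C cC; apply/subspace_continuousP => t Ct.
exact: fC.
Qed.

Lemma cvg_initial (S : choiceType) (T : topologicalType) (f : S -> T) I
    (F : set_system I) (u : I -> S) (s : S) : Filter F ->
  u @ F --> (s : initial_topology f) <-> (f \o u) @ F --> f s.
Proof.
move=> FF; split=> [us|fus].
  exact: cvg_comp us (@initial_continuous _ _ f s).
move=> A /= [_ [[B Bop <-] Bfs BA]].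
have FB : F ((f \o u) @^-1` B) by apply: fus; rewrite nbhsE; exists B.
by apply: filterS FB => i; exact: BA.
Qed.

(** * Uniform convergence on compact sets, tested at moving points *)

Section FamilyCompact.
Context (X : topologicalType) (V : uniformType).
Context (I : Type) (F : set_system I) {FF : Filter F}.
Implicit Type u : I -> X -> V.

Lemma family_compact_eval u (u0 : X -> V) x x0 : continuous u0 ->
  {family compact, u @ F --> u0} -> compact_cvg F x x0 ->
  (fun i => u i (x i)) @ F --> u0 x0.
Proof.
move=> cu0 /fam_cvgP uu0 [xx0 [C [cC Cx0 xC]]].
apply/cvg_app_entourageP => E entE.
have uC : \forall i \near F, forall y, C y -> split_ent E (u0 y, u i y).
  apply: (uu0 C cC [set h | forall y, C y -> split_ent E (u0 y, h y)]).
  by apply/uniform_nbhs; exists (split_ent E); split.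
have cux := cvg_comp _ _ xx0 (cu0 x0).
move/cvg_app_entourageP : cux => /(_ _ (entourage_split_ent entE)) ux.
have Exu i : split_ent E (u0 x0, u0 (x i)) -> C (x i) ->
    (forall y, C y -> split_ent E (u0 y, u i y)) -> E (u0 x0, u i (x i)).
  by move=> E1 Ci /(_ _ Ci) E2; apply: (@entourage_split _ (u0 (x i))).
by apply: filterS3 ux xC uC => i; exact: Exu.
Qed.

(** Converse of [family_compact_eval]. Near each point [x] of [L], both [u0 y] and eventually
    [u i y] are close to [u0 x]; compactness of [L] makes this uniform on [L]. *)
Lemma family_compact_cvg u (u0 : X -> V) : continuous u0 ->
  (forall (L : set X) x, compact L -> L x ->
    (fun p => u p.1 p.2) @ filter_prod F (within L (nbhs x)) --> u0 x) ->
  {family compact, u @ F --> u0}.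
Proof.
move=> cu0 uu0; apply/fam_cvgP => L cL P /uniform_nbhs[E [entE EP]].
have : \forall i \near F, L `<=` [set y | E (u0 y, u i y)].
  move/compact_near_coveringP/near_covering_withinP : (cL); apply => x Lx.
  have := uu0 L x cL Lx => /cvg_app_entourageP/(_ _ (entourage_split_ent entE)) ux.
  move: (cu0 x) => /cvg_app_entourageP/(_ _ (entourage_inv (entourage_split_ent entE))) u0x.
  have [[/= A B] [FA nB AB]] := ux.
  exists (u0 @^-1` [set y | (split_ent E)^-1%relation (u0 x, y)] `&`
    [set y | L y -> B y], A) => //=.
    by split=> //; apply: filterI.
  move=> [y i] /= [[Ey By] Ai] Ly.
  apply: (@entourage_split _ (u0 x)) => //; exact: (AB (i, y) (conj Ai (By Ly))).
by apply: filterS => i Li; exact: EP.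
Qed.

End FamilyCompact.

Section DualConvergence.
Context (K : numFieldType) (E : preTopologicalLmodType K).
Context (I : Type) (F : set_system I) {FF : Filter F}.
Implicit Types (l m : I -> cdual E).

Lemma cdual_cvg_eval l (l0 : cdual E) y y0 : l @ F --> l0 ->
  compact_cvg F y y0 -> (fun i => l i (y i)) @ F --> l0 y0.
Proof.
move=> /cvg_initial ll0 yy0.
exact: (family_compact_eval (@cdual_continuous _ _ l0) ll0 yy0).
Qed.

Lemma cdual_cvg l (l0 : cdual E) :
  (forall (L : set E) y, compact L -> L y ->
    (fun p => l p.1 p.2) @ filter_prod F (within L (nbhs y)) --> l0 y) ->
  l @ F --> l0.
Proof.
move=> ll0; apply/(@cvg_initial _ {family compact, E -> K^o} (@cdual_fun K E)).
exact: (family_compact_cvg (@cdual_continuous _ _ l0) ll0).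
Qed.

End DualConvergence.

Section DualTopology.
Context (K : numFieldType) (E : preTopologicalLmodType K).
Context (I : Type) (F : set_system I) {FF : Filter F}.
Implicit Types (l m : I -> cdual E).

(** Continuity of the vector space operations of $E'_c$, reduced to that of the scalars by
    evaluating at points moving in a compact set. *)
Lemma cdual_cvg_lincomb (a : K) l m (l0 m0 : cdual E) :
  l @ F --> l0 -> m @ F --> m0 ->
  (fun i => a *: l i + m i) @ F --> a *: l0 + m0.
Proof.
move=> ll0 mm0; apply: cdual_cvg => L y cL Ly.
have fstF : fst @ filter_prod F (within L (nbhs y)) --> F by exact: cvg_fst.
have sndF : compact_cvg (filter_prod F (within L (nbhs y))) snd y.
  by apply: (compact_cvg_reindex _ _ (compact_cvg_within cL Ly)); exact: cvg_snd.
apply: (@cvg_lincomb K K^o).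
  exact: (cdual_cvg_eval (cvg_comp _ _ fstF ll0) sndF).
exact: (cdual_cvg_eval (cvg_comp _ _ fstF mm0) sndF).
Qed.

(** In $b(l_i,m_i)=b(l_i-l_0,m_i)+b(l_0,m_i)$ the first term tends to 0 by hypocontinuity, as the
    [m i] stay in a compact set, and the second converges by separate continuity. *)
Lemma bracket_cvg (b : cdual E -> cdual E -> cdual E) l m (l0 m0 : cdual E) :
  c_hypocontinuous_snd b -> l @ F --> l0 -> compact_cvg F m m0 ->
  (fun i => b (l i) (m i)) @ F --> b l0 m0.
Proof.
move=> [[bl br] [bc _] bh] ll0 [mm0 [M [cM Mm0 mM]]].
have dl0 : (fun i => l i - l0) @ F --> (0 : cdual E).
  rewrite [X in _ --> X](_ : _ = -1 *: l0 + l0); last by rewrite scaleN1r addNr.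
  rewrite (_ : (fun i => _) = (fun i => -1 *: l0 + l i)).
    by apply: cdual_cvg_lincomb => //; exact: cvg_cst.
  by apply/funext => i; rewrite scaleN1r addrC.
have dbl0 : (fun i => b (l i - l0) (m i)) @ F --> (0 : cdual E).
  move=> W W0; have [V V0 VW] := bh _ _ cM W0.
  by apply: (@filterS2 _ F _ _ _ _ _ (dl0 _ V0) mM) => i Vi Mi; exact: VW.
have := cdual_cvg_lincomb (a := 1) dbl0 (cvg_comp _ _ mm0 (bc l0 m0)).
rewrite scaler0 add0r; apply: cvg_near_eq; apply: nearW => i /=.
by rewrite scale1r -[X in _ + X]scale1r addrC -bl scale1r addrC subrK.
Qed.

End DualTopology.

Section SmoothTopology.
Context (K : numFieldType) (E : preTopologicalLmodType K) (U : set E).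
Context (I : Type) (F : set_system I) {FF : Filter F}.
Implicit Types (f : I -> Cinfty K^o U).

Lemma Cinfty_smooth (f : Cinfty K^o U) : smooth f.
Proof. by case: f => f /= /asboolP. Qed.

Lemma Cinfty_cvg_eval f (f0 : Cinfty K^o U) j
    (p : I -> (U * {ptws 'I_j -> E})%type) p0 :
  f @ F --> f0 -> compact_cvg F p p0 ->
  (fun i => dn (f i) (p i)) @ F --> dn f0 p0.
Proof.
move=> ff0 pp0; have [_ /(_ j) cf0] := Cinfty_smooth f0.
have {}ff0 : {compact-open, (fun i => @dn _ _ _ _ j (f i)) @ F --> @dn _ _ _ _ j f0}.
  by move/cvg_sup: ff0 => /(_ j)/cvg_initial.
(* At a continuous limit, compact-open convergence is uniform convergence on compact sets. *)
have {}ff0 := (compact_open_fam_compactP cf0 (fmap_filter _ FF)).1 ff0.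
exact: (family_compact_eval cf0 ff0 pp0).
Qed.

Lemma Cinfty_cvg f (f0 : Cinfty K^o U) :
  (forall j (C : set (U * {ptws 'I_j -> E})) p, compact C -> C p ->
    (fun q => dn (f q.1) q.2) @ filter_prod F (within C (nbhs p)) --> dn f0 p) ->
  f @ F --> f0.
Proof.
move=> ff0; apply/cvg_sup => j; apply/cvg_initial.
have [_ /(_ j) cf0] := Cinfty_smooth f0.
apply/(compact_open_fam_compactP cf0).
exact: (family_compact_cvg cf0 (ff0 j)).
Qed.

End SmoothTopology.

Lemma compact_set_val (T : topologicalType) (A L : set T) :
  compact L -> L `<=` A -> compact (set_val @^-1` L : set A).
Proof.
move=> cL LA; apply/compact_near_coveringP => I F P FF nP.
have : \forall i \near F, L `<=` [set x | forall y : A, set_val y = x -> P i y].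
  move/compact_near_coveringP : (cL); apply => x Lx.
  have Ax := LA _ Lx; pose x' : A := SigSub (mem_set Ax).
  have [[/= B G] [nB FG] BG] := nP x' Lx.
  have [_ /= [[V oV <-] Vx' VB]] := nB.
  exists (V, G); first by split=> //; exact: open_nbhs_nbhs.
  move=> [y i] /= [Vy Gi] z zy; apply: (BG (z, i)); split=> //=.
  by apply: VB; rewrite /= zy.
by apply: filterS => i Li x Lx; exact: (Li _ Lx).
Qed.

(** * Points and translations in an open set *)

Section OpenSubset.
Context (K : numFieldType) (E : lcsType K) (U : set E).
Hypothesis hU : open U.

Lemma valLE (F : lcsType K) (f : U -> F) (x : U) : 'valL_ 0 f (set_val x) = f x.
Proof. exact: (congr1 (fun g => g x) (@valLK _ _ 0 U f)). Qed.

(* Equal to [x] when [set_val x + v] is not in [U]. *)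
Definition pshift (x : U) (v : E) : U := insubd x (set_val x + v).

Lemma pshiftE x v : U (set_val x + v) -> set_val (pshift x v) = set_val x + v.
Proof. by move=> Uxv; rewrite set_valE /pshift insubdK// inE. Qed.

Lemma valL_pshift (F : lcsType K) (f : U -> F) x v : U (set_val x + v) ->
  'valL_ 0 f (set_val x + v) = f (pshift x v).
Proof. by move=> /pshiftE <-; exact: valLE. Qed.

Lemma cvg_set_val I (F : set_system I) (x : I -> U) (x0 : U) : Filter F ->
  x @ F --> x0 <-> (set_val \o x) @ F --> set_val x0.
Proof. by move=> FF; exact: cvg_initial. Qed.

Lemma near_open I (F : set_system I) (x : I -> U) (x0 : U) (v : I -> E) : Filter F ->
  x @ F --> x0 -> v @ F --> 0 -> \forall i \near F, U (set_val (x i) + v i).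
Proof.
move=> FF /cvg_set_val xx0 v0.
have xv : (fun i => set_val (x i) + v i) @ F --> set_val x0.
  rewrite -[set_val x0]addr0.
  exact: cvg_comp (cvg_pair xx0 v0) (@add_continuous E (set_val x0, 0)).
apply: (xv U); apply: open_nbhs_nbhs; split=> //.
exact: set_valP.
Qed.

(** A compact set of [E] containing the net need not lie in [U]. By regularity of [E] it can be
    intersected with a closed neighbourhood of [x0] contained in [U]. *)
Lemma compact_cvg_set_val I (F : set_system I) (x : I -> U) (x0 : U) : Filter F ->
  compact_cvg F (set_val \o x) (set_val x0) -> compact_cvg F x x0.
Proof.
move=> FF [xx0 [C [cC Cx0 xC]]]; split; first exact/cvg_set_val.
have Ux0 : nbhs (set_val x0) U.
  by apply: open_nbhs_nbhs; split=> //; exact: set_valP.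
have [V nV VU] := @uniform_regular E _ _ Ux0.
exists (set_val @^-1` (C `&` closure V)); split.
- apply: compact_set_val; last by move=> y [_ /VU].
  by apply: compact_closedI => //; exact: closed_closure.
- by split=> //=; apply: subset_closure; exact: nbhs_singleton.
- have := xx0 _ nV; apply: filterS2 xC => i Ci Vi; split => //.
  exact: subset_closure.
Qed.

Lemma compact_cvg_pshift I (F : set_system I) (x : I -> U) (x0 : U) (v : I -> E) :
  Filter F -> compact_cvg F x x0 -> compact_cvg F v 0 ->
  compact_cvg F (fun i => pshift (x i) (v i)) x0.
Proof.
move=> FF xx0 v0; apply: compact_cvg_set_val.
have [xv [C [cC Cx0 xC]]] :
    compact_cvg F (fun i => set_val (x i) + v i) (set_val x0).
  rewrite -[set_val x0]addr0; apply: (compact_cvg_comp (@add_continuous E)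
    (u := fun i => (set_val (x i), v i)) (t := (set_val x0, 0))).
  apply: compact_cvg_pair v0.
  exact: (compact_cvg_comp (@initial_continuous U E set_val) xx0).
have nU := near_open FF xx0.1 v0.1.
split.
  by apply: cvg_near_eq xv; apply: filterS nU => i /= /pshiftE ->.
exists C; split=> //; apply: filterS2 nU xC => i /= /pshiftE ->.
by [].
Qed.

Lemma compact_cvg_scale I (F : set_system I) (t : I -> K^o) (t0 : K^o) (v : I -> E) v0 :
  Filter F -> compact_cvg F t t0 -> compact_cvg F v v0 ->
  compact_cvg F (fun i => t i *: v i) (t0 *: v0).
Proof.
move=> FF tt0 vv0.
exact: (compact_cvg_comp (@scale_continuous K E) (compact_cvg_pair tt0 vv0)).
Qed.

Lemma compact_cvg_add I (F : set_system I) (u v : I -> E) (u0 v0 : E) :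
  Filter F -> compact_cvg F u u0 -> compact_cvg F v v0 ->
  compact_cvg F (fun i => u i + v i) (u0 + v0).
Proof.
move=> FF uu0 vv0.
exact: (compact_cvg_comp (@add_continuous E) (compact_cvg_pair uu0 vv0)).
Qed.

End OpenSubset.

(** * Directional derivatives *)

Section Calculus.
Context (R : realType) (K : numFieldType) (rc : real_coordinates R K).
Context (E : lcsType K) (U : set E).
Hypothesis hU : open U.

Lemma compact_cvg_nbhs0 : compact_cvg (nbhs (0 : K^o)) id (0 : K^o).
Proof.
have [C nC cC] := compact_nbhs0 rc.
by split; [exact: cvg_id|exists C; split=> //; exact: nbhs_singleton].
Qed.

Lemma compact_cvg_dnbhs0 : compact_cvg (0 : K^o)^' id (0 : K^o).
Proof.
by apply: (compact_cvg_reindex _ _ compact_cvg_nbhs0); exact: cvg_within.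
Qed.

(** Balls around 0 are star-shaped. The mean value estimate needs control on the whole segment from
    0 to [t]. *)
Lemma nbhs0_star (A : set K^o) : nbhs 0 A ->
  nbhs 0 [set t : K^o | forall s : K, 0 <= s <= 1 -> A (s * t)].
Proof.
move=> /nbhs_ballP[e e0 eA]; apply/nbhs_ballP; exists e => // t.
rewrite /ball /= sub0r normrN => te s /andP[s0 s1]; apply: eA.
rewrite /ball /= sub0r normrN normrM (le_lt_trans _ te)// ler_piMl//.
by rewrite ger0_norm.
Qed.

Lemma cvg_mul_dnbhs0 (t : K) : t != 0 ->
  (fun h : K^o => h * t : K^o) @ 0^' --> (0 : K^o)^'.
Proof.
move=> t0 A A0; have c : (fun h : K^o => h * t : K^o) @ (0 : K^o) --> (0 : K^o).
  rewrite -[X in _ --> X](mul0r t).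
  by apply: (@cvgM K _ (nbhs (0 : K^o)) _ id (fun=> t)); [by []|exact: cvg_cst].
have cA : nbhs (0 : K^o) [set h : K^o | h * t != 0 -> A (h * t)] := c _ A0.
apply: (@filterS _ (nbhs (0 : K^o)) _ _ _ _ cA) => h /= hA h0.
by apply: hA; rewrite mulf_neq0.
Qed.

Lemma line_derivative (h : U -> K^o) v x (t : K) : t != 0 ->
  dir_derivable h v x ->
  (fun s : K^o => s^-1 * ('valL_ 0 h (set_val x + (s * t) *: v) - h x) : K^o)
    @ 0^' --> (t * dir_deriv h v x : K^o).
Proof.
move=> t0 /dir_derivableP hv.
have hvt := cvg_comp _ _ (cvg_mul_dnbhs0 t0) hv.
apply: cvg_near_eq (@cvgM K _ _ _ _ _ _ _ (cvg_cst (t : K^o)) hvt).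
apply: nearW => s /=.
by rewrite /diff_quot /GRing.scale /= invfM -mulrA mulrCA mulVKf.
Qed.

(** The mean value estimate for $\varphi(s)=t^{-1}h(x+stv)$: the factor $t^{-1}$ makes
    $\varphi(1)-\varphi(0)$ the difference quotient and $\varphi'(s)$ the directional derivative at
    $x+stv$. *)
Lemma line_mean_value (h : U -> K^o) v x (t c e : K) : t != 0 ->
  (forall s, 0 <= s <= 1 -> [/\ U (set_val x + (s * t) *: v),
     dir_derivable h v (pshift x ((s * t) *: v)) &
     `|dir_deriv h v (pshift x ((s * t) *: v)) - c| <= e]) ->
  `|diff_quot h v x t - c| <= e + e.
Proof.
move=> t0 hs.
have -> : diff_quot h v x t = t^-1 * 'valL_ 0 h (set_val x + (1 * t) *: v)
    - t^-1 * 'valL_ 0 h (set_val x + (0 * t) *: v).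
  by rewrite mul1r mul0r scale0r addr0 valLE -mulrBr.
apply: (mean_value rc (phi := fun s => t^-1 * 'valL_ 0 h (set_val x + (s * t) *: v))
  (dphi := fun s => dir_deriv h v (pshift x ((s * t) *: v)))); last first.
  by move=> s /hs[].
move=> s /hs[Us dh _]; set y := pshift x _.
have yE : set_val y = set_val x + (s * t) *: v by rewrite pshiftE.
rewrite -[dir_deriv h v y](mulKf t0).
apply: cvg_near_eq (@cvgM K _ _ _ _ _ _ _ (cvg_cst (t^-1 : K^o)) (line_derivative t0 dh)).
apply: nearW => r /=.
by rewrite -yE -(valLE h y) mulrDl scalerDl addrA -yE -mulrBr mulrCA.
Qed.

(** Convergence of the derivatives on the segments from [x i] to [x i + t *: v] forces that of the
    difference quotients. Letting [h] depend on the index serves for second differences and for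
    uniformity in a further direction. *)
Lemma diff_quot_cvg I (G : set_system I) (h : I -> U -> K^o) x (x0 : U) v (c : K^o) :
  Filter G -> x @ G --> x0 ->
  (\forall p \near filter_prod (nbhs 0) G,
    dir_derivable (h p.2) v (pshift (x p.2) (p.1 *: v))) ->
  (fun p : K^o * I => dir_deriv (h p.2) v (pshift (x p.2) (p.1 *: v)))
    @ filter_prod (nbhs 0) G --> c ->
  (fun p : K^o * I => diff_quot (h p.2) v (x p.2) p.1) @ filter_prod 0^' G --> c.
Proof.
move=> FG xx0 dh hc; apply/(@cvgrPdist_le _ K^o) => e e0.
(* The estimate of [line_mean_value] loses a factor 2. *)
have e20 : 0 < e / 2 by rewrite divr_gt0.
have nU : \forall p \near filter_prod (nbhs (0 : K^o)) G,
    U (set_val (x p.2) + p.1 *: v).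
  have v0 : (fun t : K^o => t *: v) @ (0 : K^o) --> (0 : E).
    rewrite -(scale0r v).
    exact: (compact_cvg_scale _ compact_cvg_nbhs0 (compact_cvg_cst v)).1.
  exact: (near_open hU _ (cvg_comp _ _ cvg_snd xx0) (cvg_comp _ _ cvg_fst v0)).
have [[A B] /= [nA GB] AB] :=
  filterI (filterI nU dh) (@cvgr_dist_le _ K^o _ _ _ _ _ hc _ e20).
exists ([set t : K^o | t != 0 /\ forall s : K, 0 <= s <= 1 -> A (s * t)], B).
  by split=> //=; apply: filterS (nbhs0_star nA) => t tA t0; split.
move=> [t i] /= [[t0 tA] Bi].
rewrite distrC [leRHS]splitr; apply: line_mean_value => // s s01.
have [[Us ds] sc] := AB (s * t, i) (conj (tA s s01) Bi).
by split=> //; rewrite distrC.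
Qed.

End Calculus.

(** * Convergence of lists of directions *)

Section ListCvg.
Context (T : topologicalType) (x0 : T).
Context (I : Type) (F : set_system I) {FF : Filter F}.

(** The length is constant along the whole net, so that all the derivatives taken along [s i] have
    the same order. *)
Definition list_cvg (s : I -> seq T) (s0 : seq T) :=
  (forall i, size (s i) = size s0) /\
  forall k, compact_cvg F (fun i => nth x0 (s i) k) (nth x0 s0 k).

Lemma list_cvg_cst s : list_cvg (fun=> s) s.
Proof. by split=> // k; exact: compact_cvg_cst. Qed.

Lemma list_cvg_cons u t s s0 : compact_cvg F u t -> list_cvg s s0 ->
  list_cvg (fun i => u i :: s i) (t :: s0).
Proof.
by move=> ut [ss sn]; split=> [i|[|k]] //=; rewrite ss.
Qed.

Lemma list_cvg_rcons u t s s0 : compact_cvg F u t -> list_cvg s s0 ->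
  list_cvg (fun i => rcons (s i) (u i)) (rcons s0 t).
Proof.
move=> ut [ss sn]; split=> [i|k]; first by rewrite !size_rcons ss.
rewrite nth_rcons; under eq_fun do rewrite nth_rcons ss.
case: ifP => _; first exact: sn.
by case: ifP => _ //; exact: compact_cvg_cst.
Qed.

Lemma list_cvg_behead s s0 : list_cvg s s0 ->
  list_cvg (fun i => behead (s i)) (behead s0).
Proof.
move=> [ss sn]; split=> [i|k]; first by rewrite !size_behead ss.
by rewrite nth_behead; under eq_fun do rewrite nth_behead; exact: sn.
Qed.

Lemma list_cvg_map j (u : I -> {ptws 'I_j -> T}) (t : {ptws 'I_j -> T}) :
  compact_cvg F u t ->
  list_cvg (fun i => [seq u i k | k : 'I_j]) [seq t k | k : 'I_j].
Proof.
move=> ut; split=> [i|k]; first by rewrite !size_map.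
have [kj|jk] := ltnP k j; last first.
  have E (v : {ptws 'I_j -> T}) : nth x0 [seq v k | k : 'I_j] k = x0.
    by rewrite nth_default// size_image card_ord.
  by rewrite E; under eq_fun do rewrite E; exact: compact_cvg_cst.
have E (v : {ptws 'I_j -> T}) : nth x0 [seq v k | k : 'I_j] k = v (Ordinal kj).
  rewrite (nth_map (Ordinal kj)) ?size_enum_ord//; congr (v _).
  by apply: val_inj; rewrite /= nth_enum_ord.
rewrite E; under eq_fun do rewrite E.
apply: (compact_cvg_comp (f := fun v : {ptws 'I_j -> T} => v (Ordinal kj))) => //.
exact: proj_continuous.
Qed.

End ListCvg.

Lemma list_cvg_reindex (T : topologicalType) (x0 : T) I J (F : set_system I)
    (G : set_system J) (p : J -> I) (s : I -> seq T) s0 :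
  Filter G -> p @ G --> F -> list_cvg x0 F s s0 -> list_cvg x0 G (s \o p) s0.
Proof.
move=> FG pF [ss sn]; split=> [j|k]; first exact: ss.
exact: (compact_cvg_reindex FG pF (sn k)).
Qed.

Lemma image_nth (T : Type) (x0 : T) (s : seq T) n : size s = n ->
  [seq nth x0 s k | k : 'I_n] = s.
Proof.
move=> sn; apply: (@eq_from_nth _ x0); rewrite size_image card_ord// => k kn.
rewrite (nth_map (Ordinal kn)) ?size_enum_ord//; congr (nth _ _ _).
by rewrite /= nth_enum_ord.
Qed.

Section KSmooth.
Context (R : realType) (K : numFieldType) (rc : real_coordinates R K).
Context (E : lcsType K) (U : set E).
Hypothesis hU : open U.
Implicit Types (h : U -> K^o) (x : U).

(* Smoothness with continuity required only along nets staying in compact sets. *)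
Definition ksmooth h :=
  (forall ys, iter_derivable h ys) /\
  forall (I : Type) (F : set_system I) (x : I -> U) (s : I -> seq E) x0 s0,
    Filter F -> compact_cvg F x x0 -> list_cvg 0 F s s0 ->
    (fun i => iter_deriv h (s i) (x i)) @ F --> (iter_deriv h s0 x0 : K^o).

Lemma ksmooth_deriv h v : ksmooth h -> ksmooth (dir_deriv h v).
Proof.
move=> [dh ch]; split=> [ys|I F x s x0 s0 FF xx0 ss0].
  by have [] := dh (v :: ys).
apply: (ch _ _ _ (fun i => v :: s i) _ (v :: s0)) => //.
by apply: list_cvg_cons ss0; exact: compact_cvg_cst.
Qed.

Lemma ksmooth_derivable h v x : ksmooth h -> dir_derivable h v x.
Proof. by move=> [/(_ [:: v])[]]. Qed.

Lemma ksmooth_deriv_cvg h v I (F : set_system I) (x : I -> U) x0 : ksmooth h ->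
  Filter F -> compact_cvg F x x0 ->
  (fun i => dir_deriv h v (x i)) @ F --> (dir_deriv h v x0 : K^o).
Proof.
move=> [_ ch] FF xx0; apply: (ch _ _ _ (fun=> [:: v]) _ [:: v]) => //.
exact: list_cvg_cst.
Qed.

Lemma dir_derivZ h (a : K) v x :
  dir_derivable h v x -> dir_deriv h (a *: v) x = a * dir_deriv h v x.
Proof.
move=> dh; apply: dir_derivP; have [->|a0] := eqVneq a 0.
  rewrite scale0r mul0r (_ : diff_quot h 0 x = fun=> 0); first exact: cvg_cst.
  by apply/funext => t; rewrite /diff_quot scaler0 addr0 valLE subrr scaler0.
apply: cvg_near_eq (line_derivative a0 dh); apply: nearW => t.
by rewrite -scalerA.
Qed.

Lemma cvg_diag0 : (fun t : K^o => (t, t)) @ (0 : K^o)^' -->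
  filter_prod (0 : K^o)^' (nbhs (0 : K^o)).
Proof.
move=> A [[B C] /= [nB nC] BC].
have nC' : (0 : K^o)^' C by apply: (@filterS _ (nbhs (0 : K^o)) _ _ _ _ nC).
by apply: (@filterS2 _ (0 : K^o)^' _ _ _ _ _ nB nC') => t Bt Ct; exact: (BC (t, t)).
Qed.

Lemma near_shift_open x v :
  \forall t \near (0 : K^o)^', U (set_val x + t *: v).
Proof.
apply: (near_open hU _ (cvg_cst x)).
rewrite -(scale0r v).
exact: (compact_cvg_scale _ (compact_cvg_dnbhs0 rc) (compact_cvg_cst v)).1.
Qed.

Lemma compact_cvg_line I (F : set_system I) (t : I -> K^o) (x : I -> U) x0 v :
  Filter F -> compact_cvg F t (0 : K^o) -> compact_cvg F x x0 ->
  compact_cvg F (fun i => pshift (x i) (t i *: v)) x0.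
Proof.
move=> FF tt xx0; apply: compact_cvg_pshift => //.
by rewrite -(scale0r v); apply: compact_cvg_scale => //; exact: compact_cvg_cst.
Qed.

Lemma compact_cvg_fst0 I (G : set_system I) : Filter G ->
  compact_cvg (filter_prod (nbhs (0 : K^o)) G) fst (0 : K^o).
Proof.
move=> FG.
by apply: (compact_cvg_reindex _ _ (compact_cvg_nbhs0 rc)); exact: cvg_fst.
Qed.

(** The increment along [t *: (y + z)] is the increment along [t *: z] from the moved point
    [x + t *: y], plus that along [t *: y] from [x]. The first quotient converges by
    [diff_quot_cvg], which allows moving base points. *)
Lemma dir_derivD h y z x : ksmooth h ->
  dir_deriv h (y + z) x = dir_deriv h y x + dir_deriv h z x.
Proof.
move=> kh; apply: dir_derivP.
have c0 := compact_cvg_nbhs0 rc.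
have zx : (fun p : K^o * K^o => diff_quot h z (pshift x (p.2 *: y)) p.1)
    @ filter_prod 0^' (nbhs 0) --> (dir_deriv h z x : K^o).
  have xy : compact_cvg (nbhs (0 : K^o)) (fun t : K^o => pshift x (t *: y)) x.
    by apply: compact_cvg_line c0 _ => //; exact: compact_cvg_cst.
  apply: (diff_quot_cvg rc hU (h := fun=> h) (x0 := x)) xy.1 _ _ => //.
    by apply: nearW => p; exact: ksmooth_derivable.
  apply: ksmooth_deriv_cvg => //.
  apply: compact_cvg_line; first exact: compact_cvg_fst0.
  exact: (compact_cvg_reindex _ cvg_snd xy).
have yx := dir_derivableP (ksmooth_derivable y x kh).
rewrite [dir_deriv h y x + _]addrC.
apply: cvg_near_eq (@cvgD K K^o _ _ _ _ _ _ _ (cvg_comp _ _ cvg_diag0 zx) yx).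
apply: filterS (near_shift_open x y) => t xty.
rewrite -[LHS]/(diff_quot h z (pshift x (t *: y)) t + diff_quot h y x t).
rewrite /diff_quot -scalerDr -(valLE h (pshift _ _)) pshiftE//.
by rewrite [t *: (y + z)]scalerDr [set_val x + (_ + _)]addrA subrKA.
Qed.

Lemma iter_deriv_head_linear h (a : K) y z ys : ksmooth h ->
  iter_deriv h (a *: y + z :: ys) =
    a *: iter_deriv h (y :: ys) + iter_deriv h (z :: ys) :> (U -> K^o).
Proof.
move=> kh /=.
have -> : dir_deriv h (a *: y + z) = a *: dir_deriv h y + dir_deriv h z.
  apply/funext => x; rewrite dir_derivD// dir_derivZ//.
  exact: ksmooth_derivable.
apply: (iter_deriv_lincomb _ _ _).2.
  exact: (ksmooth_deriv y kh).1.
exact: (ksmooth_deriv z kh).1.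
Qed.

End KSmooth.

(** * Symmetry of higher derivatives *)

Section Schwarz.
Context (R : realType) (K : numFieldType) (rc : real_coordinates R K).
Context (E : lcsType K) (U : set E).
Hypothesis hU : open U.
Implicit Types (h : U -> K^o) (x : U).

(** Difference quotients along [z] with fixed step [t] commute with the derivative along [y]. *)
Lemma diff_quot_derivative h y z x (t : K^o) : ksmooth h ->
  U (set_val x + t *: z) ->
  diff_quot (fun x' : U => diff_quot h z x' t : K^o) y x s @[s --> 0^'] -->
    (diff_quot (dir_deriv h y) z x t : K^o).
Proof.
move=> kh Ux; have dy x' := dir_derivableP (ksmooth_derivable y x' kh).
pose x' := pshift x (t *: z).
have x'E : set_val x' = set_val x + t *: z by exact: pshiftE.
have -> : diff_quot (dir_deriv h y) z x t = t^-1 * (dir_deriv h y x' - dir_deriv h y x).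
  by rewrite /diff_quot -x'E valLE.
have dd : (fun s : K^o => t^-1 * (diff_quot h y x' s - diff_quot h y x s) : K^o)
    @ 0^' --> (t^-1 * (dir_deriv h y x' - dir_deriv h y x) : K^o).
  apply: (@cvgM K); first exact: cvg_cst.
  exact: (@cvgB K K^o _ _ _ _ _ _ _ (dy x') (dy x)).
apply: cvg_near_eq dd; apply: filterS (near_shift_open rc hU x y) => s Us.
have -> : diff_quot (fun x' : U => diff_quot h z x' t : K^o) y x s =
    s^-1 * (diff_quot h z (pshift x (s *: y)) t - diff_quot h z x t).
  exact: (congr1 (fun w : K^o => s^-1 * (w - diff_quot h z x t))
    (valL_pshift (fun x' : U => diff_quot h z x' t : K^o) Us)).
rewrite /diff_quot -(valLE h x') -(valLE h (pshift x (s *: y))) !pshiftE//.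
rewrite [set_val x + t *: z + _]addrAC -![_^-1 *: _]/(_^-1 * _).
ring.
Qed.

(** The expression is a difference quotient along [y] of a difference quotient along [z]. Two
    applications of [diff_quot_cvg] give a limit in two independent steps, which are then set equal;
    the expression is symmetric in [y] and [z]. *)
Lemma second_difference h y z x : ksmooth h ->
  (fun t : K^o => t^-1 * (t^-1 * ('valL_ 0 h (set_val x + t *: y + t *: z)
     - 'valL_ 0 h (set_val x + t *: y) - 'valL_ 0 h (set_val x + t *: z) + h x)) : K^o)
    @ 0^' --> (dir_deriv (dir_deriv h y) z x : K^o).
Proof.
move=> kh; have k1 := ksmooth_deriv y kh.
pose FP := filter_prod (nbhs (0 : K^o)) (0 : K^o)^'.
have xy : compact_cvg FP (fun p : K^o * K^o => pshift x (p.1 *: y)) x.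
  apply: (compact_cvg_line hU); first exact: (compact_cvg_fst0 rc).
  exact: compact_cvg_cst.
have tz : compact_cvg FP snd (0 : K^o).
  by apply: (compact_cvg_reindex _ cvg_snd (compact_cvg_dnbhs0 rc)).
have nU : \forall p \near FP, U (set_val (pshift x (p.1 *: y)) + p.2 *: z).
  apply: (near_open hU _ xy.1).
  by rewrite -(scale0r z); exact: (compact_cvg_scale _ tz (compact_cvg_cst z)).1.
have lim1 : (fun p : K^o * K^o => diff_quot (dir_deriv h y) z (pshift x (p.1 *: y)) p.2)
    @ FP --> (dir_deriv (dir_deriv h y) z x : K^o).
  have swap : (fun p : K^o * K^o => (p.2, p.1)) @ FP -->
      filter_prod (0 : K^o)^' (nbhs (0 : K^o)).
    move=> A [[B C] /= [nB nC] BC]; exists (C, B) => //= -[t s] /= [Ct Bs].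
    exact: (BC (s, t)).
  have xy' : compact_cvg (nbhs (0 : K^o)) (fun t : K^o => pshift x (t *: y)) x.
    apply: (compact_cvg_line hU); first exact: (compact_cvg_nbhs0 rc).
    exact: compact_cvg_cst.
  apply: (cvg_comp _ _ swap (diff_quot_cvg rc hU (G := nbhs (0 : K^o))
    (h := fun=> dir_deriv h y) _ xy'.1 _ _)).
    by apply: nearW => p; exact: ksmooth_derivable.
  apply: ksmooth_deriv_cvg => //.
  apply: (compact_cvg_line hU); first exact: (compact_cvg_fst0 rc).
  exact: (compact_cvg_reindex _ cvg_snd xy').
(* Here the base point is fixed and the function varies: the step [t] of the inner quotient is the
   index. *)
have lim2 := diff_quot_cvg rc hU (G := 0^') (x := fun=> x) (x0 := x) (v := y)
  (h := fun (t : K^o) (x' : U) => diff_quot h z x' t : K^o)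
  (c := dir_deriv (dir_deriv h y) z x) _ (cvg_cst x).
have lim3 : (fun p : K^o * K^o =>
    diff_quot (fun x' : U => diff_quot h z x' p.2 : K^o) y x p.1)
    @ filter_prod 0^' 0^' --> (dir_deriv (dir_deriv h y) z x : K^o).
  apply: lim2.
    apply: filterS nU => p Up.
    by eexists; exact: diff_quot_derivative.
  apply: cvg_near_eq lim1; apply: filterS nU => p Up.
  by apply/esym/dir_derivP/diff_quot_derivative.
have diag : (fun t : K^o => (t, t)) @ (0 : K^o)^' --> filter_prod (0 : K^o)^' (0 : K^o)^'.
  move=> A [[B C] /= [nB nC] BC].
  by apply: (@filterS2 _ (0 : K^o)^' _ _ _ _ _ nB nC) => t Bt Ct; exact: (BC (t, t)).
apply: cvg_near_eq (cvg_comp _ _ diag lim3).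
apply: filterS2 (near_shift_open rc hU x y) (near_shift_open rc hU x z) => t Uy Uz.
transitivity (t^-1 * (diff_quot h z (pshift x (t *: y)) t - diff_quot h z x t)).
  exact: (congr1 (fun w : K^o => t^-1 * (w - diff_quot h z x t))
    (valL_pshift (fun x' : U => diff_quot h z x' t : K^o) Uy)).
rewrite /diff_quot -(valLE h (pshift x (t *: y))) !pshiftE//.
rewrite -![_^-1 *: _]/(_^-1 * _).
ring.
Qed.

Lemma dir_derivC h y z : ksmooth h ->
  dir_deriv (dir_deriv h y) z = dir_deriv (dir_deriv h z) y.
Proof.
move=> kh; apply/funext => x.
have zy : (fun t : K^o => t^-1 * (t^-1 * ('valL_ 0 h (set_val x + t *: y + t *: z)
     - 'valL_ 0 h (set_val x + t *: y) - 'valL_ 0 h (set_val x + t *: z) + h x)) : K^o)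
    @ 0^' --> (dir_deriv (dir_deriv h z) y x : K^o).
  apply: cvg_near_eq (@second_difference h z y x kh); apply: nearW => t.
  rewrite [set_val x + _ + _]addrAC.
  ring.
exact: (@cvg_unique K^o (@norm_hausdorff K K^o) _ _ _ _ (@second_difference h y z x kh) zy).
Qed.

Lemma iter_deriv_move h y s1 s2 : ksmooth h ->
  iter_deriv h (s1 ++ y :: s2) = iter_deriv h (y :: s1 ++ s2).
Proof.
elim: s1 h => [//|z s1 IH] h kh /=.
rewrite IH/=; last exact: ksmooth_deriv.
by rewrite dir_derivC.
Qed.

End Schwarz.

(** * Polarization *)

Section Polarization.
Context (K : numFieldType) (V : lmodType K).
Implicit Types (M : seq V -> K) (P : V -> K).

(** Symmetry in the form in which [iter_deriv_move] provides it; moving entries to the front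
    generates all permutations, see [symmetric_list_perm]. *)
Definition symmetric_list M := forall s1 y s2, M (s1 ++ y :: s2) = M (y :: s1 ++ s2).

Lemma symmetric_list_cons M y : symmetric_list M -> symmetric_list (fun s => M (y :: s)).
Proof.
move=> sM s1 z s2.
by rewrite -cat_cons sM -[y :: z :: _]/([:: y] ++ z :: _) sM.
Qed.

Lemma symmetric_list_perm M s t : symmetric_list M -> perm_eq s t -> M s = M t.
Proof.
elim: s t M => [|y s IH] t M sM pst.
  by have /perm_nilP -> : perm_eq t [::] by rewrite perm_sym.
have yt : y \in t by rewrite -(perm_mem pst) mem_head.
case/splitPr: yt pst => t1 t2.
rewrite -[y :: t2]cat1s perm_sym perm_catCA perm_cons perm_sym => pst.
rewrite sM; exact: (IH _ (fun s => M (y :: s)) (symmetric_list_cons _ sM)).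
Qed.

(* Iterated finite differences; they recover a symmetric multilinear map from its diagonal. *)
Fixpoint fdiff P (ys : seq V) (w : V) : K :=
  if ys is y :: ys' then fdiff P ys' (w + y) - fdiff P ys' w else P w.

Lemma fdiff_shift P ys y w : fdiff (fun w => P (w + y)) ys w = fdiff P ys (w + y).
Proof. by elim: ys w => [//|z ys IH] w /=; rewrite !IH addrAC. Qed.

Lemma fdiffB P Q ys w : fdiff (fun w => P w - Q w) ys w = fdiff P ys w - fdiff Q ys w.
Proof.
elim: ys w => [//|z ys IH] w /=; rewrite !IH.
ring.
Qed.

Lemma fdiff_sum n (c : 'I_n -> K) (P : 'I_n -> V -> K) ys w :
  fdiff (fun w => \sum_(i < n) c i * P i w) ys w = \sum_(i < n) c i * fdiff (P i) ys w.
Proof.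
elim: ys w => [//|z ys IH] w /=; rewrite !IH -sumrB.
by apply: eq_bigr => i _; rewrite mulrBr.
Qed.

Lemma eq_fdiff P Q ys w : P =1 Q -> fdiff P ys w = fdiff Q ys w.
Proof. by move=> /funext ->. Qed.

Context (M : seq V -> K) (symM : symmetric_list M).
Hypothesis addM : forall y z s, M (y + z :: s) = M (y :: s) + M (z :: s).

(** Binomial formula, by Pascal's rule. The tail [s] collects the summands split off during the
    induction. *)
Lemma symmetric_binomial k w y s : M (nseq k (w + y) ++ s) =
  \sum_(i < k.+1) 'C(k, i)%:R * M (nseq i y ++ nseq (k - i) w ++ s).
Proof.
elim: k s => [|k IH] s; first by rewrite big_ord1 bin0 mul1r.
have -> : M (nseq k.+1 (w + y) ++ s) =
    M (nseq k (w + y) ++ w :: s) + M (nseq k (w + y) ++ y :: s).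
  by rewrite /= addM !symM.
rewrite !IH [RHS]big_ord_recl [X in X + _ = _]big_ord_recl -addrA; congr (_ + _).
  rewrite !bin0 !subn0 !mul1r; apply: symmetric_list_perm symM _.
  by apply/permP => p; rewrite /= !count_cat /= addnCA.
have -> : \sum_(i < k.+1) 'C(k.+1, lift ord0 i)%:R *
      M (nseq (lift ord0 i) y ++ nseq (k.+1 - lift ord0 i) w ++ s) =
    \sum_(i < k.+1) ('C(k, i.+1)%:R * M (nseq i.+1 y ++ nseq (k - i) w ++ s)
      + 'C(k, i)%:R * M (nseq i.+1 y ++ nseq (k - i) w ++ s)).
  by apply: eq_bigr => i _; rewrite lift0 binS natrD mulrDl subSS.
rewrite big_split /=; congr (_ + _).
  rewrite [RHS]big_ord_recr /= bin_small// mul0r addr0.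
  apply: eq_bigr => i _; rewrite /bump /= add1n; congr (_ * _).
  apply: symmetric_list_perm symM _.
  rewrite -(subnSK (ltn_ord i)).
  by apply/permP => p; rewrite /= add0n !count_cat /= !count_cat /=; lia.
apply: eq_bigr => i _; congr (_ * _); apply: symmetric_list_perm symM _.
by apply/permP => p; rewrite /= !count_cat /=; lia.
Qed.

(** Each difference lowers the degree in [w] by at least one: the leading term of the binomial
    expansion cancels. Hence too low degrees are annihilated. *)
Lemma fdiff_symmetric ys k s w :
  let d := fdiff (fun w => M (nseq k w ++ s)) ys w in
  ((k < size ys)%N -> d = 0) /\ (k = size ys -> d = k`!%:R * M (ys ++ s)).
Proof.
elim: ys k s w => [|y ys IH] k s w /=; first by split=> // ->; rewrite mul1r.
have -> : fdiff (fun w => M (nseq k w ++ s)) ys (w + y) -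
    fdiff (fun w => M (nseq k w ++ s)) ys w =
  \sum_(i < k) 'C(k, i.+1)%:R *
     fdiff (fun w => M (nseq (k - i.+1) w ++ nseq i.+1 y ++ s)) ys w.
  rewrite -fdiff_shift -fdiffB -fdiff_sum; apply: eq_fdiff => u.
  rewrite symmetric_binomial big_ord_recl bin0 mul1r subn0 addrAC subrr add0r.
  apply: eq_bigr => i _; congr (_ * _); apply: symmetric_list_perm symM _.
  by rewrite perm_catCA.
split=> [ky|ky].
  rewrite big1// => i _; rewrite ((IH _ _ _).1 _) ?mulr0//.
  by have := ltn_ord i; lia.
(* Only the summand of degree [size ys] survives; its coefficient [k] builds up the factorial. *)
rewrite ky big_ord_recl /= bin1 subn1 /= big1 => [|i _]; last first.
  by rewrite ((IH _ _ _).1 _) ?mulr0// /bump /=; have := ltn_ord i; lia.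
rewrite addr0 ((IH _ _ _).2 _)// mulrA factS natrM.
by rewrite symM.
Qed.

Lemma polarization ys : M ys = (size ys)`!%:R^-1 * fdiff (fun w => M (nseq (size ys) w)) ys 0.
Proof.
have [_ /(_ erefl) d] := fdiff_symmetric ys (size ys) [::] 0.
rewrite cats0 in d; rewrite (eq_fdiff (Q := fun w => M (nseq (size ys) w ++ [::]))).
  by rewrite d mulKf// pnatr_eq0 -lt0n fact_gt0.
by move=> w; rewrite cats0.
Qed.

End Polarization.

(** * Smoothness on k_R-spaces *)

Section KSmoothSmooth.
Context (R : realType) (K : numFieldType) (rc : real_coordinates R K).
Context (E : lcsType K) (U : set E).
Hypothesis hU : open U.
Implicit Types (h : U -> K^o) (x : U).

(* Points are pulled towards [x0], by a factor supported in a convex neighbourhood of [x0]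
   contained in [U]. *)
Lemma local_retraction (x0 : U) : exists r : E -> U, continuous r /\
  \forall y \near set_val x0, set_val (r y) = y.
Proof.
have [B Bconv [Bopen Bbase]] := @locally_convex K E.
have Ux0 : nbhs (set_val x0) U.
  by apply: open_nbhs_nbhs; split=> //; exact: set_valP.
have [V [BV Vx0] VU] := Bbase _ _ Ux0.
have oV : open V by exact: Bopen.
have sepV : @uniform_separator E [set set_val x0] (~` V).
  apply: (@uniform_completely_regular R E); first exact: open_closedC.
  by move=> /(_ Vx0).
pose u := @Urysohn E R [set set_val x0] (~` V).
have cu : continuous (u : E -> R^o) by exact: Urysohn_continuous.
have u01 y : 0 <= u y <= 1.
  have : range u (u y) by exists y.
  by move/(@Urysohn_range E R); rewrite /= in_itv.
have ux0 : u (set_val x0) = 0.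
  by apply: (Urysohn_sub0 (R := R) sepV); exists (set_val x0).
have uV y : ~ V y -> u y = 1.
  by move=> nVy; apply: (Urysohn_sub1 (R := R) sepV); exists y.
(* This cut-off is 1 outside [V] and 0 where [u] is at most 1/2, hence near [x0]. *)
pose w (y : E) : R := Num.max (u y + u y - 1) 0.
have w01 y : 0 <= w y <= 1.
  have /andP[_ u1] := u01 y; rewrite /w le_max lexx orbT ge_max ler01 andbT; lra.
have cw : continuous (w : E -> R^o).
  move=> y; apply: (@continuous_max R E (fun y => u y + u y - 1 : R^o) (cst 0)).
    apply: (@cvgB R R^o); last exact: cvg_cst.
    by apply: (@cvgD R R^o); exact: cu.
  exact: cvg_cst.
pose p (y : E) : E := of_real rc (w y) *: (set_val x0 - y) + y.
have cp : continuous p.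
  move=> y.
  have cwy : (fun y : E => of_real rc (w y) : K^o) @ y --> (of_real rc (w y) : K^o).
    exact: cvg_comp (cw y) (@of_real_continuous R K rc (w y)).
  have cd : (fun y : E => set_val x0 - y) @ y --> set_val x0 - y.
    exact: (cvg_comp _ _ (cvg_pair (cvg_cst _) cvg_id)
      (@sub_continuous E (set_val x0, y))).
  have cs : (fun y : E => of_real rc (w y) *: (set_val x0 - y)) @ y -->
      of_real rc (w y) *: (set_val x0 - y).
    exact: (cvg_comp _ _ (cvg_pair cwy cd)
      (@scale_continuous K E (of_real rc (w y) : K^o, set_val x0 - y))).
  exact: (cvg_comp _ _ (cvg_pair cs cvg_id)
    (@add_continuous E (of_real rc (w y) *: (set_val x0 - y), y))).
(* Outside [V] the point is moved to [x0] itself; inside [V] it is moved along a segment of the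
   convex set [V]. *)
have pU y : U (p y).
  apply: VU; have [Vy|nVy] := pselect (V y); last first.
    rewrite /p (_ : w y = 1) ?rmorph1 ?scale1r ?subrK//.
    by rewrite /w uV// addrK max_l.
  have /andP[w0 w1] := w01 y.
  have i0 : 0 <= of_real rc (w y) by rewrite -(rmorph0 (of_real rc)) of_real_le.
  have i1 : of_real rc (w y) <= 1 by rewrite -(rmorph1 (of_real rc)) of_real_le.
  have := Bconv V (mem_set BV) (set_val x0) y (Itv01 i0 i1) (mem_set Vx0) (mem_set Vy).
  rewrite inE; congr V.
  rewrite -[LHS]/(of_real rc (w y) *: set_val x0 + (1 - of_real rc (w y)) *: y).
  by rewrite /p scalerBr scalerBl scale1r addrA addrAC.
exists (fun y => SigSub (mem_set (pU y))); split.
  by move=> y; apply/cvg_set_val; exact: cp.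
have u0 : nbhs (u (set_val x0) : R^o) [set r : R | r < 1 / 2].
  have h0 : 0 < 1 / 2 :> R by lra.
  rewrite ux0; apply: filterS (@nbhs0_lt R R^o _ h0) => r.
  exact: le_lt_trans (ler_norm r).
apply: (@filterS _ (nbhs (set_val x0)) _ _ _ _ (cu _ _ u0)) => y /= uy.
rewrite /set_val /= /p (_ : w y = 0) ?rmorph0 ?scale0r ?add0r//.
by rewrite /w max_r//; lra.
Qed.

(** Composing with a local retraction of [E] to [U] carries [phi] to $E\times E$, where the
    $k_{\mathbb R}$-property applies; near the given point [phi] is recovered from this
    composition. *)
Lemma kR_open_times (phi : U * E -> K^o) : kR_space R (E * E)%type ->
  (forall (I : Type) (F : set_system I) p p0, Filter F ->
    compact_cvg F p p0 -> (phi \o p) @ F --> phi p0) ->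
  continuous phi.
Proof.
move=> kRE cphi [x0 y0].
have [r [cr rid]] := local_retraction x0.
pose g (q : E * E) : U * E := (r q.1, q.2).
have cg : continuous g.
  move=> q; apply: cvg_pair_topology; last exact: continuous_snd.
  exact: (cvg_comp _ _ (@continuous_fst _ _ q) (cr q.1)).
have cphig : continuous (phi \o g).
  apply: (kR_spaceP rc kRE); apply: compact_cvg_continuous_within => C t cC Ct.
  exact: (cphi _ _ _ _ _ (compact_cvg_comp cg (compact_cvg_within cC Ct))).
have rx0 : r (set_val x0) = x0.
  by apply: val_inj; have := nbhs_singleton rid; rewrite !set_valE.
pose j (q : U * E) : E * E := (set_val q.1, q.2).
have cfst : (fun q : U * E => set_val q.1) @ (x0, y0) --> set_val x0.
  exact: (cvg_comp _ _ (@continuous_fst _ _ (x0, y0))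
    (@initial_continuous U E set_val x0)).
have cj : j @ (x0, y0) --> (set_val x0, y0)
  by exact: (cvg_pair_topology cfst (@continuous_snd _ _ (x0, y0))).
have phi0 := cvg_comp _ _ cj (cphig (set_val x0, y0)).
rewrite /continuous_at -[in X in _ --> X]rx0; apply: cvg_near_eq phi0.
apply: (@filterS _ (nbhs (x0, y0)) _ _ _ _ (cfst _ rid)) => -[x y] /= rx.
by congr (phi (_, _)); apply: val_inj; move: rx; rewrite !set_valE.
Qed.

Lemma fdiff_continuous (X : topologicalType) (P : X -> E -> K^o)
    (ys : seq (X -> E)) (w : X -> E) :
  continuous (fun p : X * E => P p.1 p.2) ->
  (forall k, continuous (nth (fun=> 0) ys k)) -> continuous w ->
  continuous (fun t => fdiff (P t) [seq y t | y <- ys] (w t) : K^o).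
Proof.
move=> cP; elim: ys w => [|y ys IH] w cys cw t /=.
  exact: (cvg_comp _ _ (cvg_pair_topology cvg_id (cw t)) (cP (t, w t))).
have cys' k : continuous (nth (fun=> 0) ys k) by exact: (cys k.+1).
have cwy : continuous (fun t => w t + y t).
  move=> s; exact: (cvg_comp _ _ (cvg_pair_topology (cw s) (cys 0%N s))
    (@add_continuous E (w s, y s))).
apply: (@cvgB K K^o); first exact: (IH _ cys' cwy).
exact: (IH _ cys' cw).
Qed.

(** Polarization expresses $d^jh$ by finite differences of its diagonal, whose continuity on
    $U\times E$ follows from [kR_open_times]. *)
Lemma ksmooth_smooth h : kR_space R (E * E)%type -> ksmooth h -> smooth h.
Proof.
move=> kRE kh; split=> [|j]; first exact: kh.1.
pose P (p : U * {ptws 'I_j -> E}) (w : E) : K^o := iter_deriv h (nseq j w) p.1.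
rewrite (_ : @dn _ _ _ _ j h = fun p => (j`!%:R)^-1 *
    fdiff (P p) [seq y p | y <- [seq (fun p : U * {ptws 'I_j -> E} => p.2 k) | k : 'I_j]] 0);
  last first.
  apply/funext => p; rewrite /dn.
  have symM : symmetric_list (fun s => iter_deriv h s p.1 : K).
    by move=> s1 y s2; rewrite (iter_deriv_move rc hU).
  rewrite (@polarization _ _ _ symM); last first.
    move=> y z s; have := iter_deriv_head_linear rc hU 1 y z s kh.
    by move/(congr1 (fun f => f p.1)); rewrite scale1r => ->; rewrite scale1r.
  by rewrite size_image card_ord -map_comp.
move=> p; apply: (@cvgM K); first exact: cvg_cst.
apply: fdiff_continuous; last exact: cst_continuous.
  have cjh : continuous (fun p : U * E => iter_deriv h (nseq j p.2) p.1 : K^o).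
    apply: kR_open_times => // I F q q0 FF qq0.
    apply: (kh.2 _ _ (fst \o q) (fun i => nseq j (q i).2) q0.1 (nseq j q0.2)).
    - exact: (compact_cvg_comp (f := fst) (@continuous_fst _ _)).
    - split=> [i|k]; first by rewrite !size_nseq.
      rewrite nth_nseq; under eq_fun do rewrite nth_nseq.
      case: ifP => _; last exact: compact_cvg_cst.
      exact: (compact_cvg_comp (f := snd) (@continuous_snd _ _)).
  move=> q.
  have q11 : (fun q : U * {ptws 'I_j -> E} * E => q.1.1) @ q --> q.1.1.
    exact: (cvg_comp _ _ (@continuous_fst _ _ q) (@continuous_fst _ _ q.1)).
  have q1 := cvg_pair_topology q11 (@continuous_snd _ _ q).
  exact: (cvg_comp _ _ (q1 _) (cjh (q.1.1, q.2))).
move=> k; have [jk|kj] := leqP j k.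
  by rewrite nth_default ?size_image ?card_ord//; exact: cst_continuous.
rewrite (nth_map (Ordinal kj)) ?size_enum_ord// => q.
exact: (cvg_comp _ _ (@continuous_snd _ _ q) (@proj_continuous _ (fun=> E) _ q.2)).
Qed.

End KSmoothSmooth.

(** * The Poisson bracket *)

Section Differentials.
Context (R : realType) (K : numFieldType) (rc : real_coordinates R K).
Context (E : lcsType K) (U : set E).
Hypothesis hU : open U.
Implicit Types (f g : Cinfty K^o U) (x : U).

Lemma Cinfty_iter_cvg I (F : set_system I) (f : I -> Cinfty K^o U) f0
    (x : I -> U) (x0 : U) s s0 : Filter F -> f @ F --> f0 ->
  compact_cvg F x x0 -> list_cvg 0 F s s0 ->
  (fun i => iter_deriv (f i) (s i) (x i)) @ F --> (iter_deriv f0 s0 x0 : K^o).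
Proof.
move=> FF ff0 xx0 [ss sn].
pose a (s : seq E) : {ptws 'I_(size s0) -> E} := fun k => nth 0 s k.
have aa0 : compact_cvg F (a \o s) (a s0) by apply: compact_cvg_ptws => k; exact: sn.
have dnE (h : U -> K^o) y (u : seq E) : size u = size s0 -> dn h (y, a u) = iter_deriv h u y.
  by move=> us; rewrite /dn image_nth.
rewrite -(dnE f0 x0 s0)//.
apply: cvg_near_eq (Cinfty_cvg_eval ff0 (compact_cvg_pair xx0 aa0)).
by apply: nearW => i; exact: dnE.
Qed.

Lemma Cinfty_ksmooth f : ksmooth f.
Proof.
split; first exact: (Cinfty_smooth f).1.
move=> I F x s x0 s0 FF; apply: Cinfty_iter_cvg.
exact: cvg_cst.
Qed.

(* [y |-> d^{n+1} f(x, y, s_1, ..., s_n)]; taking [y] as the first direction makes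
   linearity in [y] pass through the remaining derivatives. *)
Definition differential f (s : seq E) x : cdual E :=
  insubd 0 (fun y => iter_deriv f (y :: s) x : K^o).

(** The functional is linear and continuous, the latter because [dn] of order [(size s).+1] is, so
    [insubd] never takes its default 0. *)
Lemma differentialE f s x y : differential f s x y = iter_deriv f (y :: s) x.
Proof.
rewrite /differential -[cdual_fun _]/(val _) insubdK//; apply/asboolP; split.
  move=> a y1 y2.
  by rewrite (iter_deriv_head_linear rc hU a y1 y2 s (Cinfty_ksmooth f)).
move=> {}y; have [_ /(_ (size s).+1) cf] := Cinfty_smooth f.
pose a (y : E) : {ptws 'I_(size s).+1 -> E} := fun k => nth 0 (y :: s) k.
have dnE (z : E) : iter_deriv f (z :: s) x = dn f (x, a z).
  by rewrite /dn (@image_nth _ 0 (z :: s)).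
have ya : a @ y --> a y.
  apply: ptws_cvg => -[[|k] kn]; first exact: cvg_id.
  exact: cvg_cst.
rewrite /continuous_at dnE.
apply: cvg_near_eq (cvg_comp _ _ (cvg_pair_topology (cvg_cst x) ya) (cf (x, a y))).
by apply: nearW => z; rewrite dnE.
Qed.

Lemma differential_cvg I (F : set_system I) (f : I -> Cinfty K^o U) f0
    (x : I -> U) (x0 : U) s s0 : Filter F -> f @ F --> f0 ->
  compact_cvg F x x0 -> list_cvg 0 F s s0 ->
  (fun i => differential (f i) (s i) (x i)) @ F --> differential f0 s0 x0.
Proof.
move=> FF ff0 xx0 ss0; apply: cdual_cvg => L y cL Ly.
have fstF : fst @ filter_prod F (within L (nbhs y)) --> F by exact: cvg_fst.
have sndF : compact_cvg (filter_prod F (within L (nbhs y))) snd y.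
  by apply: (compact_cvg_reindex _ _ (compact_cvg_within cL Ly)); exact: cvg_snd.
rewrite differentialE.
under eq_fun do rewrite differentialE.
apply: (@Cinfty_iter_cvg _ _ (f \o fst) f0 (x \o fst) x0 (fun p => p.2 :: s p.1)).
- exact: cvg_comp fstF ff0.
- exact: compact_cvg_reindex fstF xx0.
- apply: list_cvg_cons => //; exact: list_cvg_reindex fstF ss0.
Qed.

(** By [differential_cvg] the differential depends continuously on function, point and directions on
    compact sets, so it stays in a compact image when these three stay in compact sets. *)
Lemma differential_compact_cvg I (F : set_system I) (f : I -> Cinfty K^o U) f0
    (x : I -> U) (x0 : U) s s0 : Filter F -> compact_cvg F f f0 ->
  compact_cvg F x x0 -> list_cvg 0 F s s0 ->
  compact_cvg F (fun i => differential (f i) (s i) (x i)) (differential f0 s0 x0).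
Proof.
move=> FF ff0 xx0 [ss sn].
pose a (s : seq E) : {ptws 'I_(size s0) -> E} := fun k => nth 0 s k.
have aa0 : compact_cvg F (a \o s) (a s0) by apply: compact_cvg_ptws => k; exact: sn.
pose D (p : Cinfty K^o U * (U * {ptws 'I_(size s0) -> E})) : cdual E :=
  differential p.1 [seq p.2.2 k | k : 'I_(size s0)] p.2.1.
have DE (h : Cinfty K^o U) y (u : seq E) : size u = size s0 ->
    D (h, (y, a u)) = differential h u y.
  by move=> us; rewrite /D image_nth.
have := compact_cvg_comp_within (f := D) _ (compact_cvg_pair ff0 (compact_cvg_pair xx0 aa0)).
rewrite DE//.
have -> : D \o (fun i => (f i, (x i, (a \o s) i))) = fun i => differential (f i) (s i) (x i).
  by apply/funext => i /=; rewrite DE.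
apply=> C t cC Ct; have cid := compact_cvg_within cC Ct.
have c1 : compact_cvg (within C (nbhs t)) fst t.1.
  exact: (compact_cvg_comp (@continuous_fst _ _) cid).
have c2 : compact_cvg (within C (nbhs t)) snd t.2.
  exact: (compact_cvg_comp (@continuous_snd _ _) cid).
apply: (@differential_cvg _ _ fst t.1 (fst \o snd) t.2.1); first exact: c1.1.
  exact: (compact_cvg_comp (@continuous_fst _ _) c2).
exact: (list_cvg_map _ (compact_cvg_comp (@continuous_snd _ _) c2)).
Qed.

Lemma ksmooth_iter (h : U -> K^o) s : ksmooth h -> ksmooth (iter_deriv h s).
Proof. by elim: s h => [//|y s IH] h kh /=; exact/IH/ksmooth_deriv. Qed.

Lemma iter_deriv_rcons (h : U -> K^o) s v :
  iter_deriv h (rcons s v) = dir_deriv (iter_deriv h s) v.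
Proof. by elim: s h => [//|y s IH] h /=. Qed.

(** Convergence in $E'_c$ asks for uniformity in [y] on compact sets. It comes from [diff_quot_cvg]
    with [y] as index of the differentiated function. *)
Lemma differential_quotient_cvg f s x v :
  (fun t : K^o => t^-1 *: (differential f s (pshift x (t *: v)) - differential f s x))
    @ (0 : K^o)^' --> differential f (rcons s v) x.
Proof.
have kf := Cinfty_ksmooth f.
apply: cdual_cvg => L y cL Ly.
have sndF (G : set_system K^o) : Filter G ->
    compact_cvg (filter_prod G (within L (nbhs y))) snd y.
  by move=> FG; apply: (compact_cvg_reindex _ _ (compact_cvg_within cL Ly)); exact: cvg_snd.
have fst0 := compact_cvg_fst0 rc (within_filter L (nbhs_filter y)).
have xt : compact_cvg (filter_prod (nbhs (0 : K^o)) (within L (nbhs y)))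
    (fun p : K^o * E => pshift x (p.1 *: v)) x.
  by apply: (compact_cvg_line hU) fst0 _; exact: compact_cvg_cst.
have quot : (fun p : K^o * E => diff_quot (iter_deriv f (p.2 :: s)) v x p.1)
    @ filter_prod 0^' (within L (nbhs y)) --> (iter_deriv f (y :: rcons s v) x : K^o).
  apply: (diff_quot_cvg rc hU (x := fun=> x) (x0 := x)
    (h := fun y' : E => iter_deriv f (y' :: s))); first exact: cvg_cst.
    by apply: nearW => p; apply: ksmooth_derivable; exact: ksmooth_iter.
  under eq_fun do rewrite -iter_deriv_rcons rcons_cons.
  apply: kf.2 xt _; apply: list_cvg_cons; first exact: sndF.
  exact: list_cvg_cst.
rewrite differentialE; apply: cvg_near_eq quot.
pose FP := filter_prod (0 : K^o)^' (within L (nbhs y)).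
have FFP : Filter FP by exact: filter_prod_filter.
have Ut : FP [set p | U (set_val x + p.1 *: v)].
  exact: (cvg_fst (near_shift_open rc hU x v)).
apply: (@filterS _ FP FFP _ _ _ Ut) => p Up; rewrite /diff_quot valL_pshift//.
by rewrite -!(differentialE f s).
Qed.

End Differentials.

(** * Derivatives of the bracket *)

Section BracketTerms.
Context (R : realType) (K : numFieldType) (rc : real_coordinates R K).
Context (E : lcsType K) (U : set E).
Hypothesis hU : open U.
Context (b : cdual E -> cdual E -> cdual E).
Hypothesis hb : c_hypocontinuous_snd b.
Hypothesis lb : lie_bracket b.
Implicit Types (f g : Cinfty K^o U) (x : U) (l m : cdual E).

Lemma bracketPl (a : K) l m n : b (a *: l + m) n = a *: b l n + b m n.
Proof. by have [[bl _] _ _] := lb; exact: bl. Qed.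

Lemma bracketPr (a : K) l m n : b n (a *: l + m) = a *: b n l + b n m.
Proof. by have [[_ br] _ _] := lb; exact: br. Qed.

Lemma bracket0l n : b 0 n = 0.
Proof.
have := bracketPl 1 0 0 n; rewrite !scale1r addr0 => /eqP.
by rewrite -subr_eq0 opprD addrA subrr add0r oppr_eq0 => /eqP.
Qed.

Lemma bracket_subl (a : K) l m n : b (a *: (l - m)) n = a *: (b l n - b m n).
Proof.
have -> : a *: (l - m) = a *: l + ((- a) *: m + 0) by rewrite addr0 scalerBr scaleNr.
by rewrite !bracketPl bracket0l addr0 scalerBr scaleNr.
Qed.

Lemma bracketC l m : b l m = - b m l.
Proof.
have [_ b0 _] := lb; apply/eqP; rewrite -addr_eq0; apply/eqP.
have := b0 (1 *: l + m).
by rewrite bracketPr !bracketPl !b0 !scale1r addr0 add0r addrC.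
Qed.

Lemma bracket_subr (a : K) l m n : b n (a *: (l - m)) = a *: (b n l - b n m).
Proof. by rewrite bracketC bracket_subl !(bracketC n) -opprD scalerN. Qed.

(* Hypocontinuity gives joint convergence as soon as one of the two arguments stays in
   a compact set, antisymmetry making the two arguments interchangeable. *)
Definition jointly_convergent (I : Type) (F : set_system I) (S : topologicalType)
    (f g : I -> S) (f0 g0 : S) : Prop :=
  [\/ continuous (fun p : cdual E * cdual E => b p.1 p.2),
      compact_cvg F f f0 | compact_cvg F g g0].

Lemma bracket_joint_cvg I (F : set_system I) (l m : I -> cdual E) l0 m0 : Filter F ->
  l @ F --> l0 -> m @ F --> m0 -> jointly_convergent F l m l0 m0 ->
  (fun i => b (l i) (m i)) @ F --> b l0 m0.
Proof.
move=> FF ll0 mm0 [cb|cl|cm]; last exact: bracket_cvg.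
  exact: (cvg_comp _ _ (cvg_pair_topology ll0 mm0) (cb (l0, m0))).
rewrite bracketC -scaleN1r -[_ *: _]addr0.
apply: cvg_near_eq (cdual_cvg_lincomb (a := -1) (bracket_cvg hb mm0 cl) (cvg_cst 0)).
by apply: nearW => i; rewrite scaleN1r addr0 -bracketC.
Qed.

(* The evaluation point is affine in [x] so that these terms are closed under directional
   derivatives: deriving it along [v] replaces [(c, z)] by [(0, c *: v)]. *)
Definition bracket_term f g (al be : seq E) (c : K) (z : E) x : K^o :=
  b (differential f al x) (differential g be x) (c *: set_val x + z).

Lemma bracket_term_cvg I (F : set_system I) (f g : I -> Cinfty K^o U) f0 g0
    (x : I -> U) (x0 : U) al al0 be be0 c (z : I -> E) (z0 : E) : Filter F ->
  f @ F --> f0 -> g @ F --> g0 -> jointly_convergent F f g f0 g0 ->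
  compact_cvg F x x0 -> list_cvg 0 F al al0 -> list_cvg 0 F be be0 ->
  compact_cvg F z z0 ->
  (fun i => bracket_term (f i) (g i) (al i) (be i) c (z i) (x i)) @ F -->
    bracket_term f0 g0 al0 be0 c z0 x0.
Proof.
move=> FF ff0 gg0 jfg xx0 aa0 bb0 zz0; rewrite /bracket_term.
apply: cdual_cvg_eval.
  apply: bracket_joint_cvg; [exact: (differential_cvg rc hU)|exact: (differential_cvg rc hU)|].
  (* A family of functions staying in a compact set has differentials staying in a compact set. *)
  case: jfg => [cb|cf|cg]; first exact: Or31 cb.
    by apply: Or32; exact: (differential_compact_cvg rc hU).
  by apply: Or33; exact: (differential_compact_cvg rc hU).
apply: compact_cvg_add zz0.
apply: compact_cvg_scale; first exact: compact_cvg_cst.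
exact: (compact_cvg_comp (@initial_continuous U E set_val) xx0).
Qed.

(** Product rule: the increment telescopes into those of the first argument, the second argument and
    the evaluation point. *)
Lemma bracket_term_deriv f g al be c z x v :
  diff_quot (bracket_term f g al be c z) v x t @[t --> (0 : K^o)^'] -->
    (bracket_term f g (rcons al v) be c z x + (bracket_term f g al (rcons be v) c z x +
     bracket_term f g al be 0 (c *: v) x) : K^o).
Proof.
have [[bl br] [bc _] _] := hb.
have xt : compact_cvg (0 : K^o)^' (fun t : K^o => pshift x (t *: v)) x.
  apply: (compact_cvg_line hU); first exact: (compact_cvg_dnbhs0 rc).
  exact: compact_cvg_cst.
pose e (y : U) := c *: set_val y + z.
have et : compact_cvg (0 : K^o)^' (fun t : K^o => e (pshift x (t *: v))) (e x).
  apply: compact_cvg_add; last exact: compact_cvg_cst.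
  apply: compact_cvg_scale; first exact: compact_cvg_cst.
  exact: (compact_cvg_comp (@initial_continuous U E set_val) xt).
have gt : compact_cvg (0 : K^o)^' (fun t : K^o => differential g be (pshift x (t *: v)))
    (differential g be x).
  apply: (differential_compact_cvg rc hU) => //; last exact: list_cvg_cst.
  exact: compact_cvg_cst.
have qf := @differential_quotient_cvg _ _ rc _ _ hU f al x v.
have qg := @differential_quotient_cvg _ _ rc _ _ hU g be x v.
pose dF t := t^-1 *: (differential f al (pshift x (t *: v)) - differential f al x).
pose dG t := t^-1 *: (differential g be (pshift x (t *: v)) - differential g be x).
(* The second argument is taken at the shifted point; it stays in a compact set, so hypocontinuity
   applies. *)
have c1 : (fun t : K^o => b (dF t) (differential g be (pshift x (t *: v)))
      (e (pshift x (t *: v)))) @ 0^' --> (bracket_term f g (rcons al v) be c z x : K^o).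
  exact: (cdual_cvg_eval (bracket_cvg hb qf gt) et).
(* The first argument is frozen at [x], so separate continuity suffices. *)
have c2 : (fun t : K^o => b (differential f al x) (dG t) (e (pshift x (t *: v))))
    @ 0^' --> (bracket_term f g al (rcons be v) c z x : K^o).
  exact: (cdual_cvg_eval (cvg_comp _ _ qg (bc (differential f al x) _)) et).
apply: cvg_near_eq (@cvgD K K^o _ _ _ _ _ _ _ c1
   (@cvgD K K^o _ _ _ _ _ _ _ c2 (cvg_cst (bracket_term f g al be 0 (c *: v) x)))).
have n0 : \forall t \near (0 : K^o)^', t != 0 by exact: nbhs_dnbhs_neq.
apply: filterS2 n0 (near_shift_open rc hU x v) => t t0 Ut.
rewrite /diff_quot valL_pshift//.
set ft := differential f al (pshift x (t *: v)).
set gt' := differential g be (pshift x (t *: v)).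
have e1 : b (dF t) gt' (e (pshift x (t *: v))) =
    t^-1 * (b ft gt' (e (pshift x (t *: v)))
            - b (differential f al x) gt' (e (pshift x (t *: v)))).
  by rewrite /dF bracket_subl.
have e2 : b (differential f al x) (dG t) (e (pshift x (t *: v))) =
    t^-1 * (b (differential f al x) gt' (e (pshift x (t *: v)))
            - b (differential f al x) (differential g be x) (e (pshift x (t *: v)))).
  by rewrite /dG bracket_subr.
(* The evaluation point is affine in [x] and functionals are linear, so this quotient is constant in
   [t]. *)
have e3 : bracket_term f g al be 0 (c *: v) x =
    t^-1 * (b (differential f al x) (differential g be x) (e (pshift x (t *: v)))
            - b (differential f al x) (differential g be x) (e x)).
  have ext : e (pshift x (t *: v)) = t *: (c *: v) + e x.
    by rewrite /e pshiftE// scalerDr -addrA addrCA !scalerA [c * t]mulrC.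
  rewrite ext cdual_linear addrK -[t *: _]/(t * _) mulKf//.
  by rewrite /bracket_term scale0r add0r.
rewrite -[LHS]/(b (dF t) gt' (e (pshift x (t *: v))) +
  (b (differential f al x) (dG t) (e (pshift x (t *: v))) +
   bracket_term f g al be 0 (c *: v) x)).
by rewrite e1 e2 e3 -!mulrDr !subrKA.
Qed.

Lemma bracket_term_dir_deriv f g al be c z v :
  dir_deriv (bracket_term f g al be c z) v =
    1 *: bracket_term f g (rcons al v) be c z +
    (1 *: bracket_term f g al (rcons be v) c z + bracket_term f g al be 0 (c *: v)).
Proof.
by apply/funext => x; rewrite !scale1r; apply: dir_derivP; exact: bracket_term_deriv.
Qed.

Lemma bracket_term_derivable f g al be c z ys :
  iter_derivable (bracket_term f g al be c z) ys.
Proof.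
elim: ys al be c z => [//|v ys IH] al be c z /=; split.
  by move=> x; eexists; exact: bracket_term_deriv.
by rewrite bracket_term_dir_deriv; do 2![apply: (iter_deriv_lincomb _ _ _).1 => //].
Qed.

Lemma bracket_term_iter_deriv f g al be c z v ys x :
  iter_deriv (bracket_term f g al be c z) (v :: ys) x =
    iter_deriv (bracket_term f g (rcons al v) be c z) ys x +
    (iter_deriv (bracket_term f g al (rcons be v) c z) ys x +
     iter_deriv (bracket_term f g al be 0 (c *: v)) ys x).
Proof.
rewrite /= bracket_term_dir_deriv.
have D := bracket_term_derivable.
rewrite (iter_deriv_lincomb 1 (D _ _ _ _ _ _ _)
  (iter_deriv_lincomb 1 (D _ _ _ _ _ _ _) (D _ _ _ _ _ _ _)).1).2.
rewrite (iter_deriv_lincomb 1 (D _ _ _ _ _ _ _) (D _ _ _ _ _ _ _)).2.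
by rewrite !scale1r.
Qed.

(** Induction on the order: a derivative yields three terms of the same kind. The lists and [z] must
    vary with the index, since the moving directions are absorbed into them. *)
Lemma bracket_term_iter_cvg I (F : set_system I) (f g : I -> Cinfty K^o U) f0 g0
    (x : I -> U) (x0 : U) ys ys0 al al0 be be0 c (z : I -> E) (z0 : E) : Filter F ->
  f @ F --> f0 -> g @ F --> g0 -> jointly_convergent F f g f0 g0 ->
  compact_cvg F x x0 -> list_cvg 0 F ys ys0 ->
  list_cvg 0 F al al0 -> list_cvg 0 F be be0 -> compact_cvg F z z0 ->
  (fun i => iter_deriv (bracket_term (f i) (g i) (al i) (be i) c (z i)) (ys i) (x i)) @ F -->
    (iter_deriv (bracket_term f0 g0 al0 be0 c z0) ys0 x0 : K^o).
Proof.
move=> FF ff0 gg0 jfg xx0.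
elim: ys0 ys al al0 be be0 c z z0 => [|v0 ys0 IH] ys al al0 be be0 c z z0 yy0 aa0 bb0 zz0.
  have := bracket_term_cvg (c := c) FF ff0 gg0 jfg xx0 aa0 bb0 zz0.
  by apply: cvg_near_eq; apply: nearW => i; have /size0nil -> := yy0.1 i.
pose v i := nth 0 (ys i) 0.
have vv0 : compact_cvg F v v0 by exact: yy0.2 0%N.
have yE i : ys i = v i :: behead (ys i).
  by rewrite /v; have := yy0.1 i; case: (ys i).
have yy0' := list_cvg_behead yy0.
have cv : compact_cvg F (fun i => c *: v i) (c *: v0).
  by apply: compact_cvg_scale => //; exact: compact_cvg_cst.
have l1 := IH _ _ _ _ _ c _ _ yy0' (list_cvg_rcons vv0 aa0) bb0 zz0.
have l2 := IH _ _ _ _ _ c _ _ yy0' aa0 (list_cvg_rcons vv0 bb0) zz0.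
have l3 := IH _ _ _ _ _ 0 _ _ yy0' aa0 bb0 cv.
rewrite bracket_term_iter_deriv.
apply: cvg_near_eq (@cvgD K K^o _ _ _ _ _ _ _ (l1 _) (@cvgD K K^o _ _ _ _ _ _ _ (l2 _) l3)).
by apply: nearW => i; rewrite [in RHS]yE bracket_term_iter_deriv.
Qed.

End BracketTerms.

(** * The bracket on $C^\infty_{\mathbb K}(U,\mathbb K)$ and its continuity *)

Section PoissonBracket.
Context (R : realType) (K : numFieldType) (rc : real_coordinates R K).
Context (E : lcsType K) (U : set E).
Hypothesis hU : open U.
Hypothesis kRE : kR_space R (E * E)%type.
Context (b : cdual E -> cdual E -> cdual E).
Hypothesis hb : c_hypocontinuous_snd b.
Hypothesis lb : lie_bracket b.
Implicit Types (f g : Cinfty K^o U) (x : U) (l m : cdual E).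

(** With empty lists, [c = 1] and [z = 0] the bracket term is $[f'(x),g'(x)](x)$; [poissonE] shows
    that it is smooth. *)
Definition poisson f g : Cinfty K^o U :=
  insubd 0 (bracket_term b f g [::] [::] 1 0).

Lemma poissonE f g : Cinfty_fun (poisson f g) = bracket_term b f g [::] [::] 1 0.
Proof.
rewrite /poisson -[Cinfty_fun _]/(val _) insubdK//; apply/asboolP.
apply: (ksmooth_smooth rc hU kRE); split=> [ys|I F x s x0 s0 FF xx0 ss0].
  exact: (bracket_term_derivable rc hU hb lb).
have cst0 : list_cvg 0 F (fun=> [::]) ([::] : seq E) by exact: list_cvg_cst.
apply: (bracket_term_iter_cvg rc hU hb lb (f := fun=> f) (g := fun=> g)) => //.
- exact: cvg_cst.
- exact: cvg_cst.
- by apply: Or33; exact: compact_cvg_cst.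
- exact: compact_cvg_cst.
Qed.

(** The common source of separate continuity, hypocontinuity and continuity, according to which case
    of [jointly_convergent] holds. *)
Lemma poisson_cvg I (F : set_system I) (f g : I -> Cinfty K^o U) f0 g0 : Filter F ->
  f @ F --> f0 -> g @ F --> g0 -> jointly_convergent b F f g f0 g0 ->
  (fun i => poisson (f i) (g i)) @ F --> poisson f0 g0.
Proof.
move=> FF ff0 gg0 jfg; apply: Cinfty_cvg => j C p cC Cp.
pose G := filter_prod F (within C (nbhs p)).
have fstF : fst @ G --> F by exact: cvg_fst.
have sndF : compact_cvg G snd p.
  by apply: (compact_cvg_reindex _ _ (compact_cvg_within cC Cp)); exact: cvg_snd.
have cst0 : list_cvg 0 G (fun=> [::]) ([::] : seq E) by exact: list_cvg_cst.
have dnE f' g' (q : U * {ptws 'I_j -> E}) : dn (poisson f' g') q =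
    iter_deriv (bracket_term b f' g' [::] [::] 1 0) [seq q.2 k | k : 'I_j] q.1.
  by rewrite -poissonE.
suff lim : (fun q : I * (U * {ptws 'I_j -> E}) =>
      iter_deriv (bracket_term b (f q.1) (g q.1) [::] [::] 1 0)
        [seq q.2.2 k | k : 'I_j] q.2.1 : K^o) @ G -->
    (iter_deriv (bracket_term b f0 g0 [::] [::] 1 0) [seq p.2 k | k : 'I_j] p.1 : K^o).
  exact: (cvg_ext (fun q => esym (dnE (f q.1) (g q.1) q.2)) (esym (dnE f0 g0 p)) lim).
apply: (bracket_term_iter_cvg rc hU hb lb (f := f \o fst) (g := g \o fst)
  (x := fst \o snd) (ys := fun q => [seq q.2.2 k | k : 'I_j])
  (al := fun=> [::]) (be := fun=> [::]) (z := fun=> 0)) => //.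
- exact: (cvg_comp _ _ fstF ff0).
- exact: (cvg_comp _ _ fstF gg0).
- case: jfg => [cb|cf|cg]; first exact: Or31 cb.
    by apply: Or32; exact: compact_cvg_reindex fstF cf.
  by apply: Or33; exact: compact_cvg_reindex fstF cg.
- exact: (compact_cvg_comp (@continuous_fst _ _) sndF).
- exact: (list_cvg_map _ (compact_cvg_comp (@continuous_snd _ _) sndF)).
- exact: compact_cvg_cst.
Qed.

Lemma differential_lincomb (a : K) f g s x :
  differential (a *: f + g) s x = a *: differential f s x + differential g s x.
Proof.
apply: val_inj; apply/funext => y.
rewrite -[LHS]/(differential (a *: f + g) s x y) (differentialE rc hU).
rewrite -[RHS]/(a *: differential f s x y + differential g s x y) !(differentialE rc hU).
have df (h : Cinfty K^o U) : iter_derivable (Cinfty_fun h) (y :: s) by exact: (Cinfty_smooth h).1.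
by have := (iter_deriv_lincomb a (df f) (df g)).2 => /(congr1 (fun h => h x)).
Qed.

Let poissonEx f g x : poisson f g x =
  b (differential f [::] x) (differential g [::] x) (1 *: set_val x + 0).
Proof. by rewrite poissonE. Qed.

(* Composing equalities, instead of rewriting with [poissonE], avoids the comparison of
   distinct elements of [Cinfty K^o U] up to conversion, which does not terminate in
   reasonable time. *)
Lemma poisson_lincombl (a : K) f1 f2 g :
  poisson (a *: f1 + f2) g = a *: poisson f1 g + poisson f2 g.
Proof.
apply: val_inj; apply/funext => x; apply: etrans (poissonEx _ _ _) _.
apply: etrans (esym (f_equal2 (fun u v : K^o => a *: u + v)
  (poissonEx f1 g x) (poissonEx f2 g x))).
pose ev l := b l (differential g [::] x) (1 *: set_val x + 0).
apply: etrans (congr1 ev (differential_lincomb a f1 f2 [::] x)) _.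
by rewrite /ev (bracketPl lb).
Qed.

Lemma poisson_lincombr (a : K) f g1 g2 :
  poisson f (a *: g1 + g2) = a *: poisson f g1 + poisson f g2.
Proof.
apply: val_inj; apply/funext => x; apply: etrans (poissonEx _ _ _) _.
apply: etrans (esym (f_equal2 (fun u v : K^o => a *: u + v)
  (poissonEx f g1 x) (poissonEx f g2 x))).
pose ev l := b (differential f [::] x) l (1 *: set_val x + 0).
apply: etrans (congr1 ev (differential_lincomb a g1 g2 [::] x)) _.
by rewrite /ev (bracketPr lb).
Qed.

Lemma poisson0l g : poisson 0 g = 0.
Proof.
have := poisson_lincombl 1 0 0 g; rewrite !scale1r addr0 => /eqP.
by rewrite -subr_eq0 opprD addrA subrr add0r oppr_eq0 => /eqP.
Qed.

Lemma poissonP f g : is_poisson_bracket b f g (poisson f g).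
Proof.
move=> x; exists (differential f [::] x), (differential g [::] x); split.
- by apply/funext => y; rewrite (differentialE rc hU).
- by apply/funext => y; rewrite (differentialE rc hU).
- by rewrite poissonE /bracket_term scale1r addr0.
Qed.

Lemma poisson_hypocontinuous : c_hypocontinuous_snd poisson.
Proof.
split.
- split=> [g a f1 f2|f a g1 g2]; [exact: poisson_lincombl|exact: poisson_lincombr].
(* The fixed function is a constant net, which stays in a compact set. *)
- split=> [f g|g f].
    have cstf : compact_cvg (nbhs g) (fun=> f) f by exact: compact_cvg_cst.
    exact: (@poisson_cvg _ (nbhs g) _ id _ _ _ cstf.1 (fun A nA => nA) (Or32 _ _ cstf)).
  have cstg : compact_cvg (nbhs f) (fun=> g) g by exact: compact_cvg_cst.
  exact: (@poisson_cvg _ (nbhs f) id _ _ _ _ (fun A nA => nA) cstg.1 (Or33 _ _ cstg)).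
- move=> M W cM W0.
  (* By [poisson_cvg], each [g0] in [M] has a neighbourhood such that [poisson f g] lies in [W] for
     [g] in its trace on [M] and [f] near 0; compactness of [M] gives one neighbourhood of 0 for all
     of [M]. *)
  have near0 : \forall f \near (0 : Cinfty K^o U), M `<=` [set g | W (poisson f g)].
    have cov := (near_covering_withinP M).2 ((compact_near_coveringP M).1 cM).
    apply: (cov _ (nbhs (0 : Cinfty K^o U)) (fun f g => W (poisson f g))) => g0 Mg0.
    pose G := filter_prod (within M (nbhs g0)) (nbhs (0 : Cinfty K^o U)).
    have gg0 : compact_cvg G fst g0.
      exact: (compact_cvg_reindex _ cvg_fst (compact_cvg_within cM Mg0)).
    have ff0 : snd @ G --> (0 : Cinfty K^o U) by exact: cvg_snd.
    have FG : Filter G by exact: filter_prod_filter.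
    have lim := poisson_cvg FG ff0 gg0.1 (Or33 _ _ gg0).
    move: lim; rewrite poisson0l => /(_ _ W0) [[A B] /= [nA nB] AB].
    exists ([set g | M g -> A g], B) => // -[g f] /= [Ag Bf] Mg.
    exact: (AB (g, f) (conj (Ag Mg) Bf)).
  exists [set f | M `<=` [set g | W (poisson f g)]] => // f g fM Mg.
  exact: fM.
Qed.

Lemma poisson_continuous : continuous (fun p : cdual E * cdual E => b p.1 p.2) ->
  continuous (fun p : Cinfty K^o U * Cinfty K^o U => poisson p.1 p.2).
Proof.
move=> cb p; apply: poisson_cvg; [exact: (@continuous_fst _ _ p)|exact: (@continuous_snd _ _ p)|].
exact: Or31 cb.
Qed.

End PoissonBracket.

Theorem theorem11p1 (R : realType) (K : numFieldType)
    (hK : real_or_complex R K) (E : lcsType K)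
    (b : cdual E -> cdual E -> cdual E) (hE : lc_poisson R b)
    (U : set E) (hU : open U) :
  exists pb : Cinfty K^o U -> Cinfty K^o U -> Cinfty K^o U,
    [/\ forall f g : Cinfty K^o U, is_poisson_bracket b f g (pb f g),
        c_hypocontinuous_snd pb &
        continuous (fun p : cdual E * cdual E => b p.1 p.2) ->
        continuous (fun p : Cinfty K^o U * Cinfty K^o U => pb p.1 p.2)].
Proof.
have [rc] := real_or_complex_coordinates hK; have [kRE _ lb hb _] := hE.
exists (@poisson K E U b); split.
- exact: (poissonP rc hU kRE hb lb).
- exact: (poisson_hypocontinuous rc hU kRE hb lb).
- exact: (poisson_continuous rc hU kRE hb lb).
Qed.
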